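(* Let $n\geq 2$ and $q,r\geq 1$ be integers, and let $S\subset \mathfrak{C}_{n,q}$ and $S'\subset \mathfrak{C}_{n,r}$ be finite, nonempty sets of rational points. Then $\mathrm{Fix}(S)$ and $\mathrm{Fix}(S')$ are isomorphic (as abstract groups) if and only if $|S|=|S'|$.
   Context: For integers $n\ge 2$, $r\ge 1$, let $\mathfrak{C}_{n,r}=\{1,\ldots,r\}\times\{1,\ldots,n\}^\omega$ be the Cantor space (product topology) of infinite sequences whose first digit lies in $\{1,\ldots,r\}$ and whose remaining digits lie in $\{1,\ldots,n\}$. For a finite prefix $\alpha\in\{1,\ldots,r\}\times\{1,\ldots,n\}^*$, the cone $C_\alpha$ is the set of all sequences in $\mathfrak{C}_{n,r}$ having $\alpha$ as a prefix. Given cones $C_\alpha$ and $C_\beta$, the prefix-replacement homeomorphism $C_\alpha\to C_\beta$ is $\alpha\psi\mapsto\beta\psi$. A homeomorphism $f\colon U\to U'$ between open sets $U\subseteq \mathfrak{C}_{n,q}$ and $U'\subseteq\mathfrak{C}_{n,r}$ is Thompson-like if each point of $U$ is contained in a cone (contained in $U$) on which $f$ restricts to a prefix replacement. The Higman--Thompson group $V_{n,r}$ is the group of all Thompson-like homeomorphisms of $\mathfrak{C}_{n,r}$. A point of $\mathfrak{C}_{n,r}$ is rational if its sequence is eventually repeating (eventually periodic). For a finite set $S$ of rational points of $\mathfrak{C}_{n,r}$, $\mathrm{Fix}(S)$ is the subgroup of $V_{n,r}$ of elements that fix $S$ pointwise; for $S\subset\mathfrak{C}_{n,q}$ it is the corresponding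 subgroup of $V_{n,q}$. *)

(* Defs.v *)
From HB Require Import structures.
From mathcomp Require Import all_boot all_order all_classical all_analysis.

Set Implicit Arguments.
Unset Strict Implicit.
Unset Printing Implicit Defensive.

Local Open Scope classical_set_scope.

(* All digits are shifted by one: {1, ..., n} is rendered as 'I_n. *)
Notation digit n := (discrete_topology 'I_n).
Notation stream n := (prod_topology (fun _ : nat => digit n)).
Notation cantor_nr n r := (digit r * stream n)%type.

(* w followed by psi: past the end of w, nth returns its default value, which
   is the shifted digit of psi. *)
Definition word_cat n (w : seq 'I_n) (psi : stream n) : stream n :=
  fun k => nth (psi (k - size w)%N) w k.

Definition prefix n r : Type := ('I_r * seq 'I_n)%type.

Definition prepend n r (alpha : prefix n r) (psi : stream n) : cantor_nr n r :=
  (alpha.1, word_cat alpha.2 psi).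

Definition cone n r (alpha : prefix n r) : set (cantor_nr n r) :=
  range (prepend alpha).

(* Locally a prefix replacement; the homeomorphism requirement is imposed
   separately, in higman_thompson. *)
Definition thompson_like n q r (U : set (cantor_nr n q))
    (f : cantor_nr n q -> cantor_nr n r) : Prop :=
  forall x, U x -> exists (alpha : prefix n q) (beta : prefix n r),
    [/\ cone alpha x, cone alpha `<=` U &
        forall psi, f (prepend alpha psi) = prepend beta psi].

Definition homeomorphism (T U : topologicalType) (f : T -> U) : Prop :=
  continuous f /\
  exists g : U -> T, [/\ continuous g, cancel f g & cancel g f].

Record higman_thompson n r := HigmanThompson {
  ht_fun :> cantor_nr n r -> cantor_nr n r;
  ht_homeo : homeomorphism ht_fun;
  ht_thompson : thompson_like setT ht_fun }.

HB.instance Definition _ n r := gen_eqMixin (higman_thompson n r).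
HB.instance Definition _ n r := gen_choiceMixin (higman_thompson n r).

Lemma ht_ext n r (f g : higman_thompson n r) : f =1 g -> f = g.
Proof.
case: f g => [f hf tf] [g hg tg] /= /funext fg.
by subst g; congr HigmanThompson; exact: Prop_irrelevance.
Qed.

Lemma word_cat_cat n (v w : seq 'I_n) (psi : stream n) :
  word_cat (v ++ w) psi = word_cat v (word_cat w psi).
Proof.
apply/funext => k; rewrite /word_cat nth_cat size_cat.
case: ltnP => kv; first exact: set_nth_default.
by rewrite [RHS]nth_default // subnDA.
Qed.

Lemma word_cat_take n m (psi : stream n) :
  psi = word_cat (mkseq psi m) (fun k => psi (m + k)%N).
Proof.
apply/funext => k; rewrite /word_cat size_mkseq.
have [km|mk] := ltnP k m; first by rewrite nth_mkseq.
by rewrite nth_default ?size_mkseq// subnKC.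
Qed.

Lemma mkseq_word_cat n (w : seq 'I_n) (psi : stream n) m :
  (m <= size w)%N -> mkseq (word_cat w psi) m = take m w.
Proof.
move=> mw; have s : size (take m w) = m by rewrite size_take_min; apply/minn_idPl.
case: m mw s => [|m] mw s; first by rewrite take0.
apply: (@eq_from_nth _ (psi 0)); first by rewrite size_mkseq s.
move=> i; rewrite size_mkseq => im.
rewrite nth_mkseq // nth_take // /word_cat.
by apply: set_nth_default; exact: leq_trans mw.
Qed.

Lemma prepend_cat n r (a : prefix n r) w psi :
  prepend (a.1, a.2 ++ w) psi = prepend a (word_cat w psi).
Proof. by rewrite /prepend /= word_cat_cat. Qed.

Lemma thompson_like_comp n q r s (f : cantor_nr n q -> cantor_nr n r)
    (g : cantor_nr n r -> cantor_nr n s) :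
  thompson_like setT f -> thompson_like setT g -> thompson_like setT (g \o f).
Proof.
move=> tf tg x _; have [a [b [[psi _ <-] _ fab]]] := tf x I.
have [c [d [[phi _ cphi] _ gcd]]] := tg (f (prepend a psi)) I.
pose m := size c.2; pose w : seq 'I_n := mkseq psi m.
have mw : (m <= size (b.2 ++ w))%N by rewrite size_cat size_mkseq leq_addl.
have psiE : psi = word_cat w (fun k => psi (m + k)%N) := word_cat_take m psi.
have bwE : b.1 = c.1 /\ take m (b.2 ++ w) = c.2.
  move: cphi; rewrite fab psiE /prepend => -[cb E]; split=> //.
  rewrite -(mkseq_word_cat (fun k => psi (m + k)%N) mw) word_cat_cat -E.
  by rewrite mkseq_word_cat // take_size.
pose u := drop m (b.2 ++ w).
exists (a.1, a.2 ++ w), (d.1, d.2 ++ u); split => //.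
  by exists (fun k => psi (m + k)%N) => //; rewrite prepend_cat -psiE.
move=> chi /=; rewrite prepend_cat fab -prepend_cat (prepend_cat d) -gcd.
rewrite -prepend_cat; congr (g (prepend _ _)).
by rewrite -bwE.2 cat_take_drop bwE.1.
Qed.

Lemma thompson_like_inv n q r (f : cantor_nr n q -> cantor_nr n r) g :
  cancel f g -> cancel g f -> thompson_like setT f -> thompson_like setT g.
Proof.
move=> fK gK tf y _; have [a [b [[psi _ psiE] _ fab]]] := tf (g y) I.
exists b, a; split => //; last by move=> chi; rewrite -fab fK.
by exists psi => //; rewrite -fab psiE gK.
Qed.

Lemma homeomorphism_id (T : topologicalType) : homeomorphism (@id T).
Proof. by split; [move=> x; exact: cvg_id|exists id; split=> // x; exact: cvg_id]. Qed.

Lemma homeomorphism_comp (T U V : topologicalType) (f : T -> U) (g : U -> V) :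
  homeomorphism f -> homeomorphism g -> homeomorphism (g \o f).
Proof.
move=> [cf [f' [cf' fK fK']]] [cg [g' [cg' gK gK']]]; split.
  by move=> x; apply: continuous_comp; [exact: cf|exact: cg].
exists (f' \o g'); split.
- by move=> x; apply: continuous_comp; [exact: cg'|exact: cf'].
- by move=> x /=; rewrite gK fK.
- by move=> x /=; rewrite fK' gK'.
Qed.

Section HigmanThompsonGroup.
Variables n r : nat.
Implicit Types f g h : higman_thompson n r.

Lemma ht_one_thompson : thompson_like setT (@id (cantor_nr n r)).
Proof.
move=> x _; exists (x.1, [::]), (x.1, [::]); split => //.
exists x.2 => //; case: x => a x; rewrite /prepend; congr pair.
by apply/funext => k; rewrite /word_cat /= nth_nil subn0.
Qed.

Definition ht_one : higman_thompson n r :=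
  HigmanThompson (homeomorphism_id _) ht_one_thompson.

Definition ht_mul f g : higman_thompson n r :=
  HigmanThompson (homeomorphism_comp (ht_homeo g) (ht_homeo f))
    (thompson_like_comp (ht_thompson g) (ht_thompson f)).

Lemma ht_inv_exists f :
  {g : higman_thompson n r | cancel f g /\ cancel g f}.
Proof.
apply: cid; have [cf [g [cg fK gK]]] := ht_homeo f.
have hg : homeomorphism g by split=> //; exists f.
by exists (HigmanThompson hg (thompson_like_inv fK gK (ht_thompson f))).
Qed.

Definition ht_inv f : higman_thompson n r := sval (ht_inv_exists f).

Lemma ht_funK f : cancel f (ht_inv f).
Proof. exact: (svalP (ht_inv_exists f)).1. Qed.

Lemma ht_invK f : cancel (ht_inv f) f.
Proof. exact: (svalP (ht_inv_exists f)).2. Qed.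

Lemma ht_mulA : associative ht_mul.
Proof. by move=> f g h; exact: ht_ext. Qed.

Lemma ht_mul1 : left_id ht_one ht_mul.
Proof. by move=> f; exact: ht_ext. Qed.

Lemma ht_mulr1 : right_id ht_one ht_mul.
Proof. by move=> f; exact: ht_ext. Qed.

Lemma ht_mulV : left_inverse ht_one ht_inv ht_mul.
Proof. by move=> f; apply: ht_ext => x /=; rewrite ht_funK. Qed.

Lemma ht_mulrV : right_inverse ht_one ht_inv ht_mul.
Proof. by move=> f; apply: ht_ext => x /=; rewrite ht_invK. Qed.

HB.instance Definition _ := isGroup.Build (higman_thompson n r)
  ht_mulA ht_mul1 ht_mulr1 ht_mulV ht_mulrV.

End HigmanThompsonGroup.

(* The first digit is irrelevant, as the repetition is only eventual. *)
Definition rational n r (x : cantor_nr n r) : Prop :=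
  exists m p : nat, (0 < p)%N /\
    forall k, (m <= k)%N -> x.2 (k + p)%N = x.2 k.

Section Fix.
Variables (n r : nat) (S : set (cantor_nr n r)).

Definition fixes : {pred higman_thompson n r} :=
  fun f => `[< forall x, S x -> f x = x >].

Lemma fixes_closed : group_closed fixes.
Proof.
split=> [|f g /asboolP ff /asboolP fg]; first exact/asboolP.
apply/asboolP => x Sx.
suff gx : (g^-1)%g x = x by rewrite /= gx ff.
by rewrite -{1}(fg _ Sx); exact: ht_funK.
Qed.

Record Fix : Type := MkFix { Fix_val :> higman_thompson n r; _ : Fix_val \in fixes }.

HB.instance Definition _ := [isSub for Fix_val].
HB.instance Definition _ := [Choice of Fix by <:].
HB.instance Definition _ :=
  SubChoice_isSubGroup.Build (higman_thompson n r) fixes Fix fixes_closed.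

End Fix.

Definition group_isomorphic (G H : groupType) : Prop :=
  exists2 f : G -> H, {morph f : x y / (x * y)%g} & bijective f.

(* Main.v *)
From HB Require Import structures.
From mathcomp Require Import all_boot all_order all_algebra all_fingroup.
From mathcomp Require Import all_classical all_analysis zify.
Require Import Defs.

Set Implicit Arguments.
Unset Strict Implicit.
Unset Printing Implicit Defensive.

Import Order.TTheory GRing.Theory Num.Theory.

(** Both directions go through a model group [model n k] that depends only on
the number [k] of fixed points (the alphabet has [n.+2] letters). It acts on
[k] disjoint sequences of cones, called ends, by bijections that replace
prefixes locally and that, far out on every end, shift the index of the cones
by a multiple of [n.+1].

A finite set [S] of [k >= 1] rational points has [Fix S] isomorphic to
[model n k] ([Fix_model_card]). Let [s] be in [S], with period word [beta]
after a prefix [alpha]. Removing [s] from the cone of [alpha] leaves the copies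
[alpha beta^a (C - C_beta)], one for each [a], and [C - C_beta] can be cut into
exactly [n.+1] pieces that are prefix-replacement images of cones, whatever the
length of [beta] ([annulus]). So the punctured cone is an end on which
prolonging the prefix by [beta] is the shift by [n.+1]. An element of [Fix S]
acts near [s] by a prefix replacement that fixes [s]; by minimality of the
period it inserts or removes copies of [beta], that is, it is a power of this
shift ([fix_center]). The finitely many remaining cones are put at the front of
one end, where they change nothing: this is why neither the number of roots
nor any count of cones modulo [n.+1] survives, and why [S] must be nonempty.

Conversely [k] is recovered as the rank of the group of homomorphisms from
[model n k] to the integers. Recording the shift at each end gives [k]
independent homomorphisms [chi i]. An element killed by all of them is
supported on finitely many cones, so it lies in a Higman-Thompson group; such a
group is generated by elements of finite order, hence any homomorphism to the
integers vanishes on it ([hom_supported]). Thus every homomorphism to the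
integers is an integral combination of the [chi i] ([hom_chi]), and an
isomorphism of model groups yields mutually inverse integer matrices
([model_rank]).

For the finite order statement, describe an element by the prefix code [Q]
that is the image of all words of length [L]. If all words of [Q] have length
[L] the element permutes cones and has finite order. Otherwise [Q] has a word
longer than [L], and by Kraft's equality also one shorter than [L]; composing
with the involution that swaps the latter with the parent of a longest word
brings [Q] closer to the uniform code ([hom_table]). *)

(** * Local prefix replacements *)

Section Glue.
Variable D : Type.
Implicit Types x y psi phi : nat -> D.

Definition glue m x psi : nat -> D :=
  fun k => if k < m then x k else psi (k - m).

Definition tl m x : nat -> D := fun k => x (m + k).

Definition agree m x y : Prop := forall k, k < m -> x k = y k.

Lemma glue0 x psi : glue 0 x psi = psi.
Proof. by apply/funext => k; rewrite /glue ltn0 subn0. Qed.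

Lemma glue_tl m x : glue m x (tl m x) = x.
Proof.
by apply/funext => k; rewrite /glue /tl; case: ltnP => // km; rewrite subnKC.
Qed.

Lemma tl_glue m x psi : tl m (glue m x psi) = psi.
Proof.
by apply/funext => k; rewrite /glue /tl ltnNge leq_addr /= addKn.
Qed.

Lemma tlD m k x : tl (m + k) x = tl k (tl m x).
Proof. by apply/funext => j; rewrite /tl addnA. Qed.

Lemma glue_agree m x psi : agree m (glue m x psi) x.
Proof. by move=> k km; rewrite /glue km. Qed.

Lemma agree_glue m x y psi : agree m x y -> glue m x psi = glue m y psi.
Proof. by move=> xy; apply/funext => k; rewrite /glue; case: ltnP => // /xy. Qed.

Lemma glueK m x psi phi : glue m (glue m x psi) phi = glue m x phi.
Proof. exact/agree_glue/glue_agree. Qed.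

Lemma glueD m k x psi : glue (m + k) x psi = glue m x (glue k (tl m x) psi).
Proof.
apply/funext => j; rewrite /glue /tl; case: (ltnP j m) => jm.
  by rewrite (ltn_addr k jm).
by rewrite ltn_subLR // subnDA; case: ltnP => // _; rewrite subnKC.
Qed.

Lemma glue_inj m x : injective (glue m x).
Proof. by move=> psi phi /(congr1 (tl m)); rewrite !tl_glue. Qed.

Lemma agree_sym m x y : agree m x y -> agree m y x.
Proof. by move=> xy k /xy. Qed.

Lemma agree_le m l x y : l <= m -> agree m x y -> agree l x y.
Proof. by move=> lm xy k kl; apply: xy; apply: leq_trans lm. Qed.

Lemma agreeP m x y : agree m x y -> y = glue m x (tl m y).
Proof. by move=> xy; rewrite (agree_glue _ xy) glue_tl. Qed.

Lemma agreeD m k x y :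
  agree (m + k) x y <-> agree m x y /\ agree k (tl m x) (tl m y).
Proof.
split=> [xy|[xy txy] j jmk].
  split=> [|j jk]; first exact: agree_le (leq_addr _ _) xy.
  by apply: xy; rewrite ltn_add2l.
case: (ltnP j m) => [/xy //|mj].
by have := txy (j - m); rewrite /tl subnKC //; apply; rewrite ltn_subLR.
Qed.

End Glue.

(** As [psi] varies, [splice m x psi] runs through the cone of the prefix of
[x] of length [m]. Points over an arbitrary root set [I] are needed, since the
model group acts on infinitely many roots. *)
Definition splice D I m (x : I * (nat -> D)) psi : I * (nat -> D) :=
  (x.1, glue m x.2 psi).

(** Naming prefixes by a point and a length makes a prefix replacement
compose, invert and restrict by rewriting, without any computation with
words. *)
Definition replaces D I J m l (f : I * (nat -> D) -> J * (nat -> D)) x : Prop :=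
  forall psi, f (splice m x psi) = splice l (f x) psi.

Definition piecewise D I J (f : I * (nat -> D) -> J * (nat -> D)) : Prop :=
  forall x, exists m l, replaces m l f x.

Section Replaces.
Variable D : Type.
Local Notation pt I := (I * (nat -> D))%type.

Lemma splice_tl I m (x : pt I) : splice m x (tl m x.2) = x.
Proof. by case: x => i x; rewrite /splice glue_tl. Qed.

Lemma spliceK I m (x : pt I) psi phi :
  splice m (splice m x psi) phi = splice m x phi.
Proof. by rewrite /splice /= glueK. Qed.

Lemma spliceD I m k (x : pt I) psi :
  splice (m + k) x psi = splice m x (glue k (tl m x.2) psi).
Proof. by rewrite /splice glueD. Qed.

Lemma splice_inj I m (x : pt I) : injective (splice m x).
Proof. by move=> psi phi [/glue_inj]. Qed.

(** The point [x] itself has the form [splice m x psi], with its own tail as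
[psi]. *)
Lemma replaces_tail I J m l (f : pt I -> pt J) x :
  replaces m l f x -> tl l (f x).2 = tl m x.2.
Proof.
by move=> /(_ (tl m x.2)); rewrite splice_tl => {1}->; rewrite tl_glue.
Qed.

Lemma replaces_shift I J k m l (f : pt I -> pt J) x :
  replaces m l f x -> replaces (m + k) (l + k) f x.
Proof.
by move=> fx psi; rewrite !spliceD fx (replaces_tail fx).
Qed.

Lemma replaces_comp I J K m l p (f : pt I -> pt J) (g : pt J -> pt K) x :
  replaces m l f x -> replaces l p g (f x) -> replaces m p (g \o f) x.
Proof. by move=> fx gx psi /=; rewrite fx gx. Qed.

Lemma piecewise_comp I J K (f : pt I -> pt J) (g : pt J -> pt K) :
  piecewise f -> piecewise g -> piecewise (g \o f).
Proof.
move=> pf pg x; have [m [l fx]] := pf x; have [l' [p gx]] := pg (f x).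
exists (m + l'), (p + l); apply: (@replaces_comp _ _ _ _ (l + l')).
  exact: replaces_shift.
by rewrite addnC; apply: replaces_shift.
Qed.

Lemma piecewise_inv I J (f : pt I -> pt J) g :
  cancel f g -> cancel g f -> piecewise f -> piecewise g.
Proof.
move=> fK gK pf y; have [m [l]] := pf (g y); rewrite /replaces gK => fy.
by exists l, m => psi; rewrite -fy fK.
Qed.

Lemma piecewise_id I : piecewise (@id (pt I)).
Proof. by move=> x; exists 0, 0. Qed.

(** Local behaviour passes through an injective chart [e]. *)
Lemma piecewise_lift I J K (e : pt J -> pt K) (f : pt I -> pt K) g :
  injective e -> piecewise e -> piecewise f -> (forall x, e (g x) = f x) ->
  piecewise g.
Proof.
move=> ei pe pf eg x; have [m [l fx]] := pf x; have [p [l' ex]] := pe (g x).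
exists (m + l'), (p + l) => psi; apply: ei.
rewrite eg (replaces_shift _ fx) -eg addnC.
by rewrite (replaces_shift _ ex).
Qed.

End Replaces.

(** * The model group with k ends *)

Section ModelGroup.
Variables n k : nat.
Local Notation D := 'I_n.+2.
Local Notation pt := (('I_k * nat) * (nat -> D))%type.

(** Far out on end [i], [f] shifts the index by [z] periods, a period being
the number [n.+1] of cones into which a cone is cut when one of its [n.+2]
immediate subcones is removed. *)
Definition shifts_end (f : pt -> pt) i (z : int) : Prop :=
  exists A B : nat, (B%:Z = A%:Z + n.+1%:Z * z)%R /\
    forall j psi, f ((i, A + j), psi) = ((i, B + j), psi).

Record model := Model {
  model_fun :> pt -> pt;
  model_inv : pt -> pt;
  model_funK : cancel model_fun model_inv;
  model_invK : cancel model_inv model_fun;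
  model_piecewise : piecewise model_fun;
  model_shifts : forall i, exists z, shifts_end model_fun i z }.

HB.instance Definition _ := gen_eqMixin model.
HB.instance Definition _ := gen_choiceMixin model.

Implicit Types f g h : model.

Lemma model_inj f : injective f.
Proof. exact: can_inj (@model_funK f). Qed.

Lemma model_ext f g : f =1 g -> f = g.
Proof.
move=> fg; have gf : model_inv f = model_inv g.
  apply/funext => x; apply: (@model_inj f).
  by rewrite model_invK fg model_invK.
case: f g fg gf => [f f' fK Kf pf sf] [g g' gK Kg pg sg] /= /funext fg gf.
by subst g g'; congr Model; exact: Prop_irrelevance.
Qed.

(** Two descriptions of the same shift can be compared on a common index, which
makes [z] an invariant of [f] and [i]. *)
Lemma shifts_end_uniq (f : pt -> pt) i z z' :
  shifts_end f i z -> shifts_end f i z' -> z = z'.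
Proof.
move=> [A [B [zE fAB]]] [A' [B' [z'E fAB']]].
have := fAB A' (fun=> ord0); rewrite [in LHS]addnC fAB' => -[E].
suff : (n.+1%:Z * z = n.+1%:Z * z')%R by apply: mulfI.
lia.
Qed.

Lemma shifts_end_id i : shifts_end id i 0.
Proof. by exists 0, 0; split => //; rewrite mulr0. Qed.

Lemma shifts_end_comp (f g : pt -> pt) i z z' :
  shifts_end f i z -> shifts_end g i z' -> shifts_end (g \o f) i (z + z')%R.
Proof.
move=> [A [B [zE fAB]]] [A' [B' [z'E fAB']]]; exists (A + A'), (B + B').
split=> [|j psi /=]; first by rewrite !PoszD zE z'E mulrDr addrACA.
by rewrite -addnA fAB addnCA fAB' addnCA addnA.
Qed.

Lemma shifts_end_inv (f g : pt -> pt) i z :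
  cancel f g -> shifts_end f i z -> shifts_end g i (- z)%R.
Proof.
move=> fK [A [B [zE fAB]]]; exists B, A.
by split=> [|j psi]; [rewrite zE mulrN addrK|rewrite -fAB fK].
Qed.

Definition model_one : model := {|
  model_fun := id; model_inv := id;
  model_funK := fun=> erefl; model_invK := fun=> erefl;
  model_piecewise := @piecewise_id _ _;
  model_shifts := fun i => ex_intro _ _ (shifts_end_id i) |}.

Lemma model_mul_shifts f g i : exists z, shifts_end (f \o g) i z.
Proof.
have [z gz] := model_shifts g i; have [z' fz'] := model_shifts f i.
by exists (z + z')%R; apply: shifts_end_comp.
Qed.

Definition model_mul f g : model := {|
  model_fun := f \o g; model_inv := model_inv g \o model_inv f;
  model_funK := can_comp (@model_funK f) (@model_funK g);
  model_invK := can_comp (@model_invK g) (@model_invK f);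
  model_piecewise := piecewise_comp (@model_piecewise g) (@model_piecewise f);
  model_shifts := model_mul_shifts f g |}.

Lemma model_inv_shifts f i : exists z, shifts_end (model_inv f) i z.
Proof.
have [z fz] := model_shifts f i.
by exists (- z)%R; apply: shifts_end_inv fz; apply: model_funK.
Qed.

Definition model_V f : model := {|
  model_fun := model_inv f; model_inv := f;
  model_funK := @model_invK f; model_invK := @model_funK f;
  model_piecewise :=
    piecewise_inv (@model_funK f) (@model_invK f) (@model_piecewise f);
  model_shifts := model_inv_shifts f |}.

Lemma model_mulA : associative model_mul.
Proof. by move=> f g h; apply: model_ext. Qed.

Lemma model_mul1 : left_id model_one model_mul.
Proof. by move=> f; apply: model_ext. Qed.

Lemma model_mulr1 : right_id model_one model_mul.
Proof. by move=> f; apply: model_ext. Qed.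

Lemma model_mulV : left_inverse model_one model_V model_mul.
Proof. by move=> f; apply: model_ext => x /=; rewrite model_funK. Qed.

Lemma model_mulrV : right_inverse model_one model_V model_mul.
Proof. by move=> f; apply: model_ext => x /=; rewrite model_invK. Qed.

HB.instance Definition _ := isGroup.Build model
  model_mulA model_mul1 model_mulr1 model_mulV model_mulrV.

Lemma model_mulE f g x : (f * g)%g x = f (g x).
Proof. by []. Qed.

(** * The characters of the model group *)

Definition chi i f : int := sval (cid (model_shifts f i)).

Lemma chiP i f : shifts_end f i (chi i f).
Proof. exact: svalP (cid (model_shifts f i)). Qed.

Lemma chi_eq i f z : shifts_end f i z -> chi i f = z.
Proof. exact: shifts_end_uniq (chiP i f). Qed.

Lemma chiM i f g : chi i (f * g)%g = (chi i f + chi i g)%R.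
Proof. by apply: chi_eq; rewrite addrC; apply: shifts_end_comp (chiP i g) (chiP i f). Qed.

Lemma chiV i f : chi i (f^-1)%g = (- chi i f)%R.
Proof. by apply: chi_eq; apply: shifts_end_inv (chiP i f); apply: model_funK. Qed.

(** Opening the first cone of an end into its [n.+2] subcones pushes the rest
of that end outwards by one period. *)
Definition push i (x : pt) : pt :=
  if x.1.1 == i then
    if x.1.2 == 0 then ((i, val (x.2 0)), tl 1 x.2)
    else ((i, x.1.2 + n.+1), x.2)
  else x.

Definition pull i (x : pt) : pt :=
  if x.1.1 == i then
    if x.1.2 < n.+2 then ((i, 0), glue 1 (fun=> inord x.1.2) x.2)
    else ((i, x.1.2 - n.+1), x.2)
  else x.

Lemma pushK i : cancel (push i) (pull i).
Proof.
move=> [[i' j] x]; rewrite /push /=; case: (eqVneq i' i) => [->|ne] /=; last first.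
  by rewrite /pull /= (negPf ne).
case: eqP => [->|/eqP j0]; rewrite /pull /= eqxx.
  rewrite ltn_ord; congr (_, _); rewrite -[RHS](glue_tl 1).
  by apply: agree_glue => -[|//] _; rewrite inord_val.
have -> : (j + n.+1 < n.+2) = false by lia.
by rewrite addnK.
Qed.

Lemma pullK i : cancel (pull i) (push i).
Proof.
move=> [[i' j] x]; rewrite /pull /=; case: (eqVneq i' i) => [->|ne] /=; last first.
  by rewrite /push /= (negPf ne).
case: ltnP => jn; rewrite /push /= eqxx; first by rewrite tl_glue /glue /= inordK.
have -> : (j - n.+1 == 0) = false by lia.
by rewrite subnK // ltnW.
Qed.

Lemma push_piecewise i : piecewise (push i).
Proof.
move=> [[i' j] x]; case: (eqVneq i' i) => [->|ne]; last first.
  by exists 0, 0 => psi; rewrite /splice /push /= (negPf ne) /= !glue0.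
case: (eqVneq j 0) => [->|j0].
  exists 1, 0 => psi; rewrite /splice /push /= eqxx /= glue0 tl_glue.
  by rewrite /glue.
by exists 0, 0 => psi; rewrite /splice /push /= eqxx (negPf j0) /= !glue0.
Qed.

Lemma push_shifts i j : shifts_end (push i) j (Posz (j == i)).
Proof.
case: eqVneq => [->|ne] /=; last first.
  exists 0, 0; split=> [|t psi]; first by rewrite mulr0.
  by rewrite /push /= (negPf ne).
exists 1, (n.+2); split=> [|t psi]; first by rewrite mulr1.
by rewrite /push /= eqxx; congr (_, _, _); lia.
Qed.

Lemma push_shifts_ex i j : exists z, shifts_end (push i) j z.
Proof. by eexists; apply: push_shifts. Qed.

Definition push_model i : model :=
  Model (@pushK i) (@pullK i) (@push_piecewise i) (push_shifts_ex i).

Lemma chi_push i j : chi j (push_model i) = (Posz (j == i)).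
Proof. exact/chi_eq/push_shifts. Qed.

End ModelGroup.

(** * Words and prefix codes *)

Section Words.
Variable D : eqType.
Implicit Types (w : seq D) (x y psi : nat -> D).

Definition catw w psi : nat -> D := fun k => nth (psi (k - size w)) w k.

Definition starts w y : bool := mkseq y (size w) == w.

Lemma catw_glue w psi phi : glue (size w) (catw w psi) phi = catw w phi.
Proof.
apply/funext => k; rewrite /glue /catw; case: ltnP => kw.
  exact: set_nth_default.
by rewrite nth_default.
Qed.

Lemma tl_catw w psi : tl (size w) (catw w psi) = psi.
Proof. by rewrite -(catw_glue w psi psi) tl_glue. Qed.

Lemma mkseq_agree m x y : (mkseq x m = mkseq y m) <-> agree m x y.
Proof.
split=> [xy k km|xy].
  by rewrite -(nth_mkseq (x 0) x km) -(nth_mkseq (x 0) y km) xy.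
by apply/eq_in_map => k; rewrite mem_iota => /andP[_]; apply: xy.
Qed.

Lemma catw_mkseq m x psi : catw (mkseq x m) psi = glue m x psi.
Proof.
apply/funext => k; rewrite /catw /glue size_mkseq; case: ltnP => km.
  by rewrite nth_mkseq.
by rewrite nth_default ?size_mkseq.
Qed.

Lemma starts_catw w psi : starts w (catw w psi).
Proof.
apply/eqP; apply: (@eq_from_nth _ (psi 0)); first by rewrite size_mkseq.
move=> k; rewrite size_mkseq => kw; rewrite nth_mkseq // /catw.
exact: set_nth_default.
Qed.

Lemma startsP w y : starts w y -> y = catw w (tl (size w) y).
Proof.
by move=> wy; rewrite -[LHS](glue_tl (size w)) -catw_mkseq (eqP wy).
Qed.

Lemma starts_rcons w d y : starts (rcons w d) y = starts w y && (y (size w) == d).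
Proof. by rewrite /starts size_rcons mkseqS eqseq_rcons. Qed.

Lemma mkseq_take l m y : l <= m -> take l (mkseq y m) = mkseq y l.
Proof. by move=> lm; rewrite /mkseq -map_take take_iota (minn_idPl lm). Qed.

Lemma starts_prefix w w' y : size w <= size w' -> starts w' y ->
  starts w y = seq.prefix w w'.
Proof.
by move=> ww' /eqP yw'; rewrite prefixE -yw' mkseq_take.
Qed.

Lemma prefix_take w u : seq.prefix w u -> u = w ++ drop (size w) u.
Proof. by rewrite prefixE => /eqP wu; rewrite -{1}wu cat_take_drop. Qed.

End Words.

(** Koenig's lemma: a word is good if one bound serves all its infinite
extensions; a bad word has a bad one-letter extension because the alphabet is
finite, and an infinite branch of bad words contradicts the local bound at that
branch. It makes the depth of a local prefix replacement uniform. *)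
Lemma fan (D : finType) (d0 : D) (P : (nat -> D) -> nat -> Prop) :
  (forall y m m', m <= m' -> P y m -> P y m') ->
  (forall y, exists m, forall y', agree m y y' -> P y' m) ->
  exists L, forall y, P y L.
Proof.
move=> Pmono Ploc.
pose good w := exists L, forall y, starts w y -> P y L.
suff [L PL] : good [::] by exists L => y; apply: PL.
apply: contrapT => bad0.
have step w : exists d, ~ good w -> ~ good (rcons w d).
  have [gd|/existsNP[d nd]] := pselect (forall d, good (rcons w d)); last first.
    by exists d.
  exists d0 => -[]; have [L PL] := choice gd.
  exists (\max_d L d) => y wy; apply: (Pmono _ (L (y (size w)))).
    exact: leq_bigmax.
  by apply: PL; rewrite starts_rcons wy eqxx.
have [next nextP] := choice step.
pose W := fix W m := if m is m'.+1 then rcons (W m') (next (W m')) else [::].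
have badW m : ~ good (W m) by elim: m => //= m; apply: nextP.
pose y k := next (W k).
have WE m : W m = mkseq y m by elim: m => //= m IH; rewrite mkseqS -IH.
have [m ym] := Ploc y; apply: (badW m); exists m => y' /eqP.
rewrite WE size_mkseq => y'm; apply: ym.
by apply/mkseq_agree.
Qed.

(** Kraft's equality for a complete prefix code with root set [F]: a word of
length [M] extends exactly one leaf, so these words are counted by the pairs of
a leaf and a completion of it. *)
Lemma kraft (F T D : finType) (d0 : D) (t : T -> F * seq D) M :
  (forall i y, exists p, (t p).1 = i /\ starts (t p).2 y) ->
  (forall p p' y, (t p).1 = (t p').1 -> starts (t p).2 y ->
     starts (t p').2 y -> p = p') ->
  (forall p, size (t p).2 <= M) ->
  \sum_p #|D| ^ (M - size (t p).2) = #|F| * #|D| ^ M.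
Proof.
move=> cover disj tM.
pose U := {p : T & (M - size (t p).2).-tuple D}.
have cU : #|{: U}| = \sum_p #|D| ^ (M - size (t p).2).
  rewrite card_tagged sumnE big_map big_enum /=.
  by apply: eq_bigr => p _; rewrite card_tuple.
have sz (u : U) : size ((t (tag u)).2 ++ tagged u) == M.
  by rewrite size_cat size_tuple subnKC.
pose h (u : U) : F * M.-tuple D := ((t (tag u)).1, Tuple (sz u)).
have h_inj : injective h.
  case=> [p v] [p' v'] [ti] tv; have pp' : p = p'.
    apply: (disj p p' (catw ((t p).2 ++ v) (fun=> d0))) => //.
      rewrite (@starts_prefix _ _ ((t p).2 ++ v)) ?prefix_prefix ?starts_catw //.
      by rewrite size_cat leq_addr.
    rewrite tv (@starts_prefix _ _ ((t p').2 ++ v')) ?prefix_prefix ?starts_catw //.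
    by rewrite size_cat leq_addr.
  subst p'; congr existT; apply: val_inj => /=.
  by move/eqP: tv; rewrite eqseq_cat // eqxx => /eqP.
rewrite -cU -card_tuple -card_prod -(card_codom h_inj).
apply: eq_card => -[i v]; rewrite !inE; apply/codomP.
have [p [pi pv]] := cover i (catw v (fun=> d0)).
move: pv; rewrite (@starts_prefix _ _ v) ?starts_catw ?size_tuple // => pv.
have sd : size (drop (size (t p).2) v) == M - size (t p).2.
  by rewrite size_drop size_tuple.
exists (existT _ p (Tuple sd)); rewrite /h /= pi; congr (_, _).
by apply: val_inj => /=; apply: prefix_take.
Qed.

(** * Swapping two disjoint cones *)

Section Swap.
Variables I D : eqType.
Implicit Types (a b : I * seq D) (x : I * (nat -> D)).

Definition prep a psi : I * (nat -> D) := (a.1, catw a.2 psi).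

Definition in_cone a x : bool := (x.1 == a.1) && starts a.2 x.2.

Lemma in_cone_prep a psi : in_cone a (prep a psi).
Proof. by rewrite /in_cone eqxx starts_catw. Qed.

Lemma in_coneP a x : in_cone a x -> x = prep a (tl (size a.2) x.2).
Proof. by case: x => i x /andP[/= /eqP -> /startsP]; rewrite /prep => <-. Qed.

Lemma splice_prep a psi phi : splice (size a.2) (prep a psi) phi = prep a phi.
Proof. by rewrite /splice catw_glue. Qed.

Lemma prep_inj a : injective (prep a).
Proof. by move=> psi phi [/(congr1 (tl (size a.2)))]; rewrite !tl_catw. Qed.

(** Exchanges the cones of [a] and [b] by prefix replacement; meaningful when
they are disjoint. *)
Definition swap a b x : I * (nat -> D) :=
  if in_cone a x then prep b (tl (size a.2) x.2)
  else if in_cone b x then prep a (tl (size b.2) x.2) else x.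

Variables a b : I * seq D.
Hypothesis ab : forall x, in_cone a x -> in_cone b x -> False.

Lemma swapl psi : swap a b (prep a psi) = prep b psi.
Proof. by rewrite /swap in_cone_prep tl_catw. Qed.

Lemma swapr psi : swap a b (prep b psi) = prep a psi.
Proof.
rewrite /swap in_cone_prep tl_catw.
by case: ifP => // /ab; case; apply: in_cone_prep.
Qed.

Lemma swap_out x : ~~ in_cone a x -> ~~ in_cone b x -> swap a b x = x.
Proof. by rewrite /swap => /negPf -> /negPf ->. Qed.

Lemma swapK : involutive (swap a b).
Proof.
move=> x; have [/in_coneP->|xa] := boolP (in_cone a x).
  by rewrite swapl swapr.
have [/in_coneP->|xb] := boolP (in_cone b x); first by rewrite swapr swapl.
by rewrite !swap_out.
Qed.

Lemma in_cone_splice c m x psi :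
  size c.2 <= m -> in_cone c (splice m x psi) = in_cone c x.
Proof.
move=> cm; rewrite /in_cone /splice /= /starts; congr (_ && (_ == _)).
by apply/mkseq_agree/(agree_le cm)/glue_agree.
Qed.

Lemma swap_piecewise : piecewise (swap a b).
Proof.
move=> x; have [/in_coneP->|xa] := boolP (in_cone a x).
  exists (size a.2), (size b.2) => psi.
  by rewrite splice_prep !swapl splice_prep.
have [/in_coneP->|xb] := boolP (in_cone b x).
  exists (size b.2), (size a.2) => psi.
  by rewrite splice_prep !swapr splice_prep.
exists (maxn (size a.2) (size b.2)), (maxn (size a.2) (size b.2)) => psi.
by rewrite !swap_out // in_cone_splice // ?leq_maxl ?leq_maxr.
Qed.

End Swap.

(** * Homomorphisms from the model group to the integers *)

Section Homs.
Variables n k : nat.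
Local Notation D := 'I_n.+2.
Local Notation pt := (('I_k * nat) * (nat -> D))%type.

Definition supported J (f : pt -> pt) : Prop :=
  forall x, J <= x.1.2 -> f x = x.

Lemma supported_shifts J f i : supported J f -> shifts_end f i 0.
Proof.
move=> fJ; exists J, J; split=> [|j psi]; first by rewrite mulr0 addr0.
by rewrite fJ //= leq_addr.
Qed.

Section SwapModel.
Variables a b : ('I_k * nat) * seq D.
Hypothesis ab : forall x, in_cone a x -> in_cone b x -> False.

Lemma swap_supported J : a.1.2 < J -> b.1.2 < J -> supported J (swap a b).
Proof.
move=> aJ bJ x Jx; apply: swap_out; apply: contraTN Jx => /andP[/eqP-> _];
by rewrite -ltnNge.
Qed.

Lemma swap_shifts i : exists z, shifts_end (swap a b) i z.
Proof.
exists 0%R; apply: (@supported_shifts (maxn a.1.2 b.1.2).+1).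
by apply: swap_supported; rewrite ltnS ?leq_maxl ?leq_maxr.
Qed.

Definition swap_model : model n k :=
  Model (swapK ab) (swapK ab) (swap_piecewise ab) swap_shifts.

Lemma swap_modelK : (swap_model * swap_model)%g = 1%g.
Proof. by apply: model_ext => x; rewrite model_mulE /= swapK. Qed.

End SwapModel.

Variable phi : model n k -> int.
Hypothesis phiM : forall f g, phi (f * g)%g = (phi f + phi g)%R.

Lemma hom1 : phi 1%g = 0%R.
Proof. by apply: (@addrI _ (phi 1%g)); rewrite -phiM mulg1 addr0. Qed.

Lemma homX f m : phi (f ^+ m)%g = (phi f *+ m)%R.
Proof. by elim: m => [|m IH]; rewrite ?expg0 ?hom1 ?expgS ?mulrS ?phiM ?IH. Qed.

Lemma hom_torsion f m : 0 < m -> (f ^+ m)%g = 1%g -> phi f = 0%R.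
Proof.
move=> m0 fm; have := homX f m; rewrite fm hom1 => /esym/eqP.
by rewrite mulrn_eq0 (gtn_eqF m0) /= => /eqP.
Qed.

Lemma homV f : phi (f^-1)%g = (- phi f)%R.
Proof. by apply/eqP; rewrite -addr_eq0 -phiM mulVg hom1. Qed.

Section FiniteSupport.
Variables J L : nat.
Local Notation F := ('I_k * 'I_J)%type.
Local Notation T := (F * L.-tuple D)%type.

Definition root (i : F) : 'I_k * nat := (i.1, nat_of_ord i.2).

Lemma root_inj : injective root.
Proof. by move=> [i j] [i' j'] [-> /val_inj ->]. Qed.

Definition cell (p : F * seq D) : ('I_k * nat) * seq D := (root p.1, p.2).

Definition table (g : pt -> pt) (t : T -> F * seq D) : Prop :=
  forall (p : T) psi, g (prep (cell (p.1, val p.2)) psi) = prep (cell (t p)) psi.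

Lemma cell_point (i : F) (y : nat -> D) :
  (root i, y) = prep (cell (i, val [tuple of mkseq y L])) (tl L y).
Proof. by rewrite /prep /= catw_mkseq glue_tl. Qed.

Section Table.
Variables (g : model n k) (t : T -> F * seq D).
Hypothesis gJ : supported J g.
Hypothesis gt : table g t.

(** Since [g] is a bijection preserving the union of the roots in [F], the
images of the cones of depth [L] form a complete prefix code. *)
Lemma table_cover i y : exists p, (t p).1 = i /\ starts (t p).2 y.
Proof.
have [[[i' j'] x] gx] : exists x, g x = (root i, y).
  by exists (model_inv g (root i, y)); rewrite model_invK.
have j'J : j' < J.
  rewrite ltnNge; apply/negP => Jj'; move: gx; rewrite gJ // => -[_ jE _].
  by have := ltn_ord i.2; rewrite -jE ltnNge Jj'.
have := cell_point (i', Ordinal j'J) x; rewrite {1}/root /= => xE.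
move: gx; rewrite xE (gt (i', Ordinal j'J, _)).
set p := (_, _); rewrite /prep /= => -[p1 p2 <-]; exists p.
by split; [apply: root_inj; rewrite /root p1 p2|apply: starts_catw].
Qed.

Lemma table_disj p p' y : (t p).1 = (t p').1 -> starts (t p).2 y ->
  starts (t p').2 y -> p = p'.
Proof.
move=> pp' /startsP yp /startsP yp'.
have : prep (cell (t p)) (tl (size (t p).2) y)
     = prep (cell (t p')) (tl (size (t p').2) y).
  by rewrite /prep /= -yp -yp' pp'.
rewrite -!gt => /model_inj; rewrite /prep /= => -[E1 E2 E3].
have E : p.1 = p'.1 by apply: root_inj; rewrite /root E1 E2.
case: p p' {pp' yp yp' E1 E2} E E3 => [i u] [i' u'] /= -> E.
congr (_, _); apply: val_inj; have := congr1 (fun z => mkseq z L) E.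
have st (v : L.-tuple D) psi : mkseq (catw v psi) L = v.
  by have /eqP := starts_catw v psi; rewrite size_tuple.
by rewrite !st.
Qed.

Lemma table_kraft M : (forall p, size (t p).2 <= M) ->
  \sum_p #|D| ^ (M - size (t p).2) = #|{: F}| * #|D| ^ M.
Proof. exact: (kraft ord0 table_cover table_disj). Qed.

(** If no leaf is deeper than [L], all have depth exactly [L] by Kraft's
equality: [g] permutes the cones of depth [L], so it has finite order. *)
Lemma hom_shallow : (forall p, size (t p).2 <= L) -> phi g = 0%R.
Proof.
move=> tL; have sz p : size (t p).2 == L.
  have D1 : 1 < #|D| by rewrite card_ord.
  have [Dpos D0] : (forall m, 0 < #|D| ^ m) /\ 0 < #|D| by split=> [m|]; rewrite ?expn_gt0 ltnW.
  (* There are as many leaves as words of length [L], so each summand of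
     Kraft's equality, being at least one, is exactly one. *)
  have E : \sum_p (#|D| ^ (L - size (t p).2)).-1 + \sum_(p : T) 1 = \sum_(p : T) 1.
    rewrite -big_split /= sum1_card card_prod card_tuple -(table_kraft tL).
    by apply: eq_bigr => q _; rewrite addn1 prednK.
  have /eqP : \sum_p (#|D| ^ (L - size (t p).2)).-1 = 0 by lia.
  rewrite sum_nat_eq0 => /forallP/(_ p)/=.
  rewrite -subn1 subn_eq0 -(expn0 #|D|) leq_exp2l // leqn0 subn_eq0 => Ls.
  by rewrite eqn_leq tL Ls.
pose s p : T := ((t p).1, Tuple (sz p)).
have s_inj : injective s.
  move=> p p' [E1 E2]; apply: (table_disj (y := catw (t p).2 (fun=> ord0))) => //.
    exact: starts_catw.
  by rewrite -E2; exact: starts_catw.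
have gs m p psi : (g ^+ m)%g (prep (cell (p.1, val p.2)) psi) =
    prep (cell ((iter m s p).1, val (iter m s p).2)) psi.
  elim: m => [|m IH] //=; rewrite expgS model_mulE IH gt.
  by [].
pose N := #[perm s_inj]%g.
apply: (@hom_torsion _ N); first exact: order_gt0.
apply: model_ext => -[[i j] x].
have [Jj|jJ] := leqP J j.
  elim: N => [|m IH]; first by rewrite expg0.
  by rewrite expgSr model_mulE gJ.
have := cell_point (i, Ordinal jJ) x; rewrite {1}/root /= => ->.
rewrite (gs _ (i, Ordinal jJ, _)).
by rewrite -(eq_iter (permE s_inj)) -permX expg_order perm1.
Qed.
End Table.

Lemma prep_rcons (a : ('I_k * nat) * seq D) e psi :
  prep (a.1, rcons a.2 e) psi = prep a (glue 1 (fun=> e) psi).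
Proof.
rewrite /prep /=; congr (_, _); apply/funext => j.
rewrite /catw /glue nth_rcons size_rcons.
case: ltnP => ja; first exact: set_nth_default.
rewrite [RHS]nth_default // ltnS leqn0 subn_eq0 eqn_leq ja andbT.
by case: leqP => // aj; rewrite subnS subn1.
Qed.

(** While some leaf is deeper than [L], Kraft's equality provides a leaf
shallower than [L]; swapping it with the parent of a deepest leaf lowers the
total excess depth, and a swap is an involution. *)
Lemma hom_table N (g : model n k) t : supported J g -> table g t ->
  \sum_p (size (t p).2 - L) <= N -> phi g = 0%R.
Proof.
elim: N g t => [|N IH] g t gJ gt tN.
  apply: (hom_shallow gJ gt) => p; move: tN; rewrite leqn0 sum_nat_eq0.
  by move=> /forallP/(_ p)/=; rewrite subn_eq0.
have [|/existsNP[p1 /negP]] := pselect (forall p, size (t p).2 <= L).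
  exact: (hom_shallow gJ gt).
rewrite -ltnNge => Lp1.
have [p0 _ p0max] := @arg_maxnP _ p1 xpredT (fun p => size (t p).2) isT.
have {Lp1} Lp0 : L < size (t p0).2 by apply: leq_trans Lp1 (p0max p1 isT).
have disj := table_disj gt.
(* Without a leaf shallower than [L], every summand of Kraft's equality would
   be at most [#|D| ^ (M - L)], and the one of [p0] smaller. *)
have [q0 q0L] : exists q, size (t q).2 < L.
  apply: contrapT => /forallNP tL; set M := size (t p0).2 in Lp0 p0max.
  have tM p : size (t p).2 <= M by apply: p0max.
  have D1 : 1 < #|D| by rewrite card_ord.
  have le p : #|D| ^ (M - size (t p).2) <= #|D| ^ (M - L).
    by rewrite leq_exp2l // leq_sub2l // leqNgt; apply/negP/tL.
  have E : \sum_p (#|D| ^ (M - L) - #|D| ^ (M - size (t p).2))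
      + \sum_p #|D| ^ (M - size (t p).2) = \sum_p #|D| ^ (M - size (t p).2).
    rewrite -big_split /= (table_kraft gJ gt tM).
    under eq_bigr => p _ do rewrite subnK //.
    rewrite sum_nat_const card_prod card_tuple -mulnA -expnD subnKC //.
    exact: ltnW.
  have /eqP : \sum_p (#|D| ^ (M - L) - #|D| ^ (M - size (t p).2)) = 0.
    by move: E; lia.
  rewrite sum_nat_eq0 => /forallP/(_ p0)/=.
  by rewrite subnn expn0 subn_eq0 -(expn0 #|D|) leq_exp2l // leqn0 subn_eq0 leqNgt Lp0.
case E0 : (t p0) => [i0 w] in Lp0 p0max *.
case/lastP: w => [//|b d] in E0 Lp0 p0max *.
rewrite /= size_rcons ltnS in Lp0; rewrite /= size_rcons in p0max.
have neq : p0 != q0.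
  by apply: contraTneq q0L => <-; rewrite E0 /= size_rcons -leqNgt ltnW.
set q := (t q0).2 in q0L *.
(* [B] is the parent of the deepest leaf [t p0]; as no leaf is deeper, all the
   leaves inside [B] are its children. *)
pose B := cell (i0, b); pose Q := cell (t q0).
have p0_only p y : (t p).1 = i0 -> size (t p).2 <= size b -> starts b y ->
    starts (t p).2 y -> p = p0.
  move=> pi0 pb yb; rewrite (starts_prefix pb yb) => pre.
  apply: (disj p p0 (catw (rcons b d) y)); rewrite ?E0 //= ?starts_catw //.
  rewrite (@starts_prefix _ _ (rcons b d)) ?starts_catw //.
    by apply: prefix_trans pre _; rewrite prefix_rcons.
  by rewrite size_rcons ltnW.
have BQ x : in_cone B x -> in_cone Q x -> False.
  move=> /andP[/eqP xB bx] /andP[/eqP xQ qx].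
  move/eqP: neq; apply; apply/esym/(p0_only q0 x.2) => //.
    by apply: root_inj; exact: etrans (esym xQ) xB.
  by rewrite ltnW // (leq_trans q0L).
pose h := swap_model BQ.
have hJ : supported J h by apply: swap_supported; apply: ltn_ord.
have phih : phi h = 0%R.
  by apply: (@hom_torsion _ 2) => //; rewrite expgS expg1 swap_modelK.
(* Swapping [B] and [Q] moves each child of [B] to a child of [Q], and the leaf
   [Q] to [B]. *)
pose child p := ((t p).1 == i0) && ((t p).2 == rcons b (last d (t p).2)).
pose t' p := if p == q0 then (i0, b) else
  if child p then ((t q0).1, rcons q (last d (t p).2)) else t p.
have t'P : table (h * g)%g t'.
  move=> p psi; rewrite model_mulE gt; rewrite -[model_fun h _]/(swap B Q _) /t'; case: (eqVneq p q0) => [->|pq0].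
    exact: swapr BQ _.
  case: ifP => [/andP[/eqP pi0 /eqP pb]|nchild].
    have -> : cell (t p) = (B.1, rcons B.2 (last d (t p).2)).
      by rewrite /cell /B /= pi0 -pb.
    rewrite prep_rcons swapl.
    by rewrite -prep_rcons.
  apply: swap_out; apply/negP => /andP[/eqP /root_inj /= E st]; last first.
    move/eqP: pq0; apply; apply: (disj _ _ _ E _ st).
    exact: starts_catw.
  have [le|] := leqP (size (t p).2) (size b).
    have pp0 := p0_only p _ E le st (starts_catw _ _).
    by move: le; rewrite pp0 E0 /= size_rcons ltnn.
  move=> lt; have pb : size (t p).2 = (size b).+1.
    by apply/eqP; rewrite eqn_leq lt andbT; apply: p0max.
  move/negP: nchild; apply; rewrite /child E eqxx /=.
  clear lt; move: pb st; case/lastP: (t p).2 => [//|u e]; rewrite size_rcons => -[ub].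
  rewrite (@starts_prefix _ b (rcons u e)) ?starts_catw ?size_rcons ?ub //.
  by rewrite last_rcons prefixE -ub -{1}cats1 take_size_cat // => /eqP ->.
have t'N : \sum_p (size (t' p).2 - L) <= N.
  rewrite -ltnS; apply: leq_trans tN.
  (* The leaf moved to [B] gains one less than [p0] loses, and no other leaf
     gains excess depth. *)
  rewrite (bigD1 q0) //= (bigD1 p0) //= [X in _ < X](bigD1 q0) //=.
  rewrite [X in _ < _ + X](bigD1 p0) //=.
  rewrite {1 2}/t' eqxx (negPf neq) /child E0 /= last_rcons !eqxx /=.
  rewrite !size_rcons -/q.
  have le : \sum_(p | (p != q0) && (p != p0)) (size (t' p).2 - L) <=
      \sum_(p | (p != q0) && (p != p0)) (size (t p).2 - L).
    apply: leq_sum => p /andP[pq0 pp0]; rewrite /t' (negPf pq0).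
    by case: ifP => // _; rewrite /= size_rcons; lia.
  have -> : size q - L = 0 by lia.
  have -> : (size q).+1 - L = 0 by lia.
  by rewrite !add0n -addSn -subSn //; apply: leq_add => //; apply: le.
have := IH _ _ _ t'P t'N; rewrite phiM phih add0r; apply => x Jx.
by rewrite model_mulE gJ // hJ.
Qed.

End FiniteSupport.

(** By compactness a finitely supported element replaces prefixes uniformly on
all cones of some depth [L] in its support, so it has a table. *)
Lemma hom_supported J (g : model n k) : supported J g -> phi g = 0%R.
Proof.
move=> gJ.
have uni (i : 'I_k * 'I_J) : exists L, forall y, exists l, replaces L l g (root i, y).
  apply: (fan ord0) => [y m m' mm' [l gl]|y].
    by exists (l + (m' - m)); move: (replaces_shift (m' - m) gl); rewrite subnKC.
  have [m [l gl]] := model_piecewise g (root i, y).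
  exists m => y' yy'; exists l => psi.
  have sE z : splice m (root i, y') z = splice m (root i, y) z.
    by rewrite /splice /= (agree_glue _ (agree_sym yy')).
  by rewrite -{2}(splice_tl m (root i, y')) !sE !gl spliceK.
have [Ls LsP] := choice uni.
pose L := \max_i Ls i.
have repl (i : 'I_k * 'I_J) y : exists l, replaces L l g (root i, y).
  have [l gl] := LsP i y; exists (l + (L - Ls i)).
  by move: (replaces_shift (L - Ls i) gl); rewrite subnKC // leq_bigmax.
have row (p : ('I_k * 'I_J) * L.-tuple D) : exists q : ('I_k * 'I_J) * seq D,
    forall psi, g (prep (cell (p.1, val p.2)) psi) = prep (cell q) psi.
  case: p => i u.
  pose x : pt := (root i, catw u (fun=> ord0)).
  have [l gl] := repl i (catw u (fun=> ord0)).
  have gxJ : (g x).1.2 < J.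
    rewrite ltnNge; apply/negP => Jg; have /model_inj gx := gJ _ Jg.
    by move: Jg; rewrite gx /= leqNgt ltn_ord.
  exists (((g x).1.1, Ordinal gxJ), mkseq (g x).2 l) => psi /=.
  have -> : prep (cell (i, val u)) psi = splice L x psi.
    by rewrite /splice /= -{2}(size_tuple u) catw_glue.
  by rewrite gl /splice /prep /cell /root /= catw_mkseq -surjective_pairing.
have [t tP] := choice row.
exact: (@hom_table J L _ g t gJ tP (leqnn _)).
Qed.

End Homs.

(** A shift by zero is the identity far out, and there are finitely many
ends. *)
Lemma chi0_supported n k (g : model n k) :
  (forall i, chi i g = 0%R) -> exists J, supported J g.
Proof.
move=> g0.
have ends i : exists A, forall j psi, A <= j -> g ((i, j), psi) = ((i, j), psi).
  have [A [B [E gAB]]] := chiP i g; rewrite g0 mulr0 addr0 in E.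
  by exists A => j psi /subnKC <-; rewrite gAB; case: E => ->.
have [A AP] := choice ends; exists (\max_i A i) => -[[i j] x] /= Aj.
by apply: AP; apply: leq_trans Aj; apply: leq_bigmax.
Qed.

(** Correcting [g] by powers of the [push_model i] makes all its characters
vanish, which leaves a finitely supported element. *)
Lemma hom_push0 n k (phi : model n k -> int) :
  (forall f g, phi (f * g)%g = (phi f + phi g)%R) ->
  (forall i, phi (push_model n i) = 0%R) -> forall g, phi g = 0%R.
Proof.
move=> phiM phi0 g.
(* An element of the kernel of phi with the same characters as g. *)
suff [h [h0 hg]] : exists h, phi h = 0%R /\ forall i, chi i h = chi i g.
  have gh0 i : chi i (g * h^-1)%g = 0%R by rewrite chiM chiV hg subrr.
  have [J /(hom_supported phiM)] := chi0_supported gh0.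
  by rewrite phiM (homV phiM) h0 subr0.
suff [h [h0 hg]] : exists h, phi h = 0%R /\
    forall i, chi i h = (if i \in enum 'I_k then chi i g else 0)%R.
  by exists h; split=> // i; rewrite hg mem_enum.
elim: (enum 'I_k) (enum_uniq 'I_k) => [|i s IH] /=.
  move=> _; exists 1%g; split=> [|i]; first exact: hom1.
  exact/chi_eq/shifts_end_id.
move=> /andP[si /IH[h [h0 hs]]].
have [p [p0 pi]] : exists p, phi p = 0%R /\
    forall j, chi j p = (Posz (j == i) * chi i g)%R.
  have pow m : phi (push_model n i ^+ m)%g = 0%R /\
      forall j, chi j (push_model n i ^+ m)%g = (Posz (j == i) * m%:Z)%R.
    split=> [|j]; first by rewrite homX // phi0 mul0rn.
    have chiMj (f g' : model n k) : chi j (f * g')%g = (chi j f + chi j g')%R.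
      exact: chiM.
    by rewrite (homX chiMj) chi_push -mulr_natr natz.
  case: (chi i g) => m; first by exists (push_model n i ^+ m)%g; apply: pow.
  exists ((push_model n i ^+ m.+1)^-1)%g; have [pm cm] := pow m.+1.
  by split=> [|j]; [rewrite homV // pm oppr0|rewrite chiV cm NegzE mulrN].
exists (p * h)%g; split=> [|j]; first by rewrite phiM p0 h0.
rewrite chiM pi hs in_cons; case: eqVneq => [->|_] /=.
  by rewrite mul1r (negPf si) addr0.
by rewrite mul0r add0r.
Qed.

(** The difference of both sides is a homomorphism that vanishes on the elements
dual to the characters. *)
Lemma hom_chi n k (phi : model n k -> int) :
  (forall f g, phi (f * g)%g = (phi f + phi g)%R) ->
  forall g, phi g = (\sum_i chi i g * phi (push_model n i))%R.
Proof.
move=> phiM g; apply/eqP; rewrite -subr_eq0; apply/eqP.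
pose psi g := (phi g - \sum_i chi i g * phi (push_model n i))%R.
apply: (@hom_push0 _ _ psi) => [f f'|i]; rewrite /psi.
  rewrite phiM addrACA -opprD -big_split /=; congr (_ - _)%R.
  by apply: eq_bigr => i _; rewrite chiM mulrDl.
rewrite (bigD1 i) //= chi_push eqxx mul1r big1 ?addr0 ?subrr // => j ji.
by rewrite chi_push (negPf ji) mul0r.
Qed.

(** Expanding the characters of the target, composed with [F], in the characters
of the source gives the matrix [A]; [B] comes from [G] in the same way, and
composing the two homomorphisms multiplies the matrices. *)
Lemma model_rank_le n k l (F : model n k -> model n l) (G : model n l -> model n k) :
  {morph F : x y / (x * y)%g} -> {morph G : x y / (x * y)%g} -> cancel F G ->
  k <= l.
Proof.
move=> FM GM FK.
pose A : 'M[int]_(k, l) := (\matrix_(i, j) chi j (F (push_model n i)))%R.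
pose B : 'M[int]_(l, k) := (\matrix_(j, i) chi i (G (push_model n j)))%R.
apply: (@mulmx1_min _ _ _ A B); apply/matrixP => i i'; rewrite !mxE.
under eq_bigr => j _ do rewrite !mxE.
have <- := @hom_chi n l (fun h => chi i' (G h)).
  by rewrite FK chi_push eq_sym; case: eqP.
by move=> f g; rewrite GM chiM.
Qed.

Lemma model_rank n k l : group_isomorphic (model n k) (model n l) -> k = l.
Proof.
move=> [F FM [G FK GK]].
have GM : {morph G : x y / (x * y)%g}.
  by move=> x y; apply: (can_inj FK); rewrite FM !GK.
apply/eqP; rewrite eqn_leq (model_rank_le FM GM FK).
exact: model_rank_le GM FM GK.
Qed.

Local Open Scope classical_set_scope.
Local Open Scope card_scope.


(** * Thompson-like homeomorphisms as piecewise prefix replacements *)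

Section Thompson.
Variable n : nat.
Local Notation D := 'I_n.+2.
Local Notation cantor r := (cantor_nr n.+2 r).

Lemma nbhs_digit r (x : cantor r) k : nbhs x [set y : cantor r | y.2 k = x.2 k].
Proof.
have c2 : (fun y : cantor r => y.2 k) @ x --> x.2 k.
  have pk : (fun z : stream n.+2 => z k) @ x.2 --> x.2 k.
    exact: (@proj_continuous nat (fun=> discrete_topology D) k x.2).
  exact: (cvg_comp snd (fun z : stream n.+2 => z k) cvg_snd pk).
exact: (c2 _ (@discrete_set1 (discrete_topology D) (x.2 k))).
Qed.

Lemma nbhs_cylinder r (x : cantor r) m :
  nbhs x [set y : cantor r | y.1 = x.1 /\ agree m x.2 y.2].
Proof.
elim: m => [|m IH].
  have c1 : (fun y : cantor r => y.1) @ x --> x.1 by apply: cvg_fst.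
  have near1 : nbhs x [set y : cantor r | y.1 = x.1].
    exact: (c1 _ (@discrete_set1 (discrete_topology 'I_r) x.1)).
  by apply: filterS near1 => y yx; split; first exact: yx.
apply: filterS (filterI IH (nbhs_digit x m)) => y [[y1 xy] ym].
split=> [|k]; first exact: y1.
by rewrite ltnS leq_eqVlt => /orP[/eqP->|/xy //]; exact: esym ym.
Qed.

Lemma cvg_stream (T : topologicalType) (x : T) (g : T -> stream n.+2) :
  (forall k, \forall y \near x, g y k = g x k) -> g @ x --> g x.
Proof.
move=> gx; have Fg : Filter (g @ x) by exact: fmap_filter.
have [_] := @cvg_sup (nat -> D) nat (fun k => Topological.class
  (initial_topology (fun y : nat -> discrete_topology D => y k))) _ (g x) Fg.
apply=> k A /= [_ [[B oB <-] Bx BA]]; rewrite nbhs_filterE.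
by apply: filterS (gx k) => y E; apply: BA; rewrite /= E.
Qed.

(** Each digit of [f y] depends on finitely many digits of [y] near [x]. *)
Lemma piecewise_continuous r s (f : cantor r -> cantor s) :
  piecewise f -> continuous f.
Proof.
move=> pf x; have [m [l fx]] := pf x.
have near k : \forall y \near x, (f y).1 = (f x).1 /\ agree (l + k) (f x).2 (f y).2.
  apply: filterS (nbhs_cylinder x (m + k)) => y [y1 xy].
  have -> : y = splice (m + k) x (tl (m + k) y.2).
    rewrite /splice /= (agree_glue _ xy) glue_tl -y1.
    by apply: surjective_pairing.
  rewrite (replaces_shift k fx); split=> //.
  exact/agree_sym/glue_agree.
have c1 : (fun y => (f y).1) @ x --> (f x).1.
  move=> A /nbhs_singleton Ax; apply: filterS (near 0) => y [E _].
  by rewrite /= E.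
have c2 : (fun y => (f y).2) @ x --> (f x).2.
  apply: cvg_stream => k; apply: filterS (near k.+1) => y [_ E].
  by rewrite -E // addnS ltnS leq_addl.
have fE : (fun y => ((f y).1, (f y).2)) = f.
  by apply/funext => y; rewrite -surjective_pairing.
by move=> A fA; have := cvg_pair c1 c2; rewrite fE; apply.
Qed.

Lemma piecewise_homeomorphism r (f g : cantor r -> cantor r) :
  piecewise f -> cancel f g -> cancel g f -> homeomorphism f.
Proof.
move=> pf fK gK; split; first exact: piecewise_continuous.
exists g; split=> //; apply: piecewise_continuous.
exact: piecewise_inv fK gK pf.
Qed.

Lemma prependE r (a : prefix n.+2 r) psi : prepend a psi = prep a psi.
Proof. by []. Qed.

Lemma splice_prepE r m (x : cantor r) psi :
  splice m x psi = prep (x.1, mkseq x.2 m) psi.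
Proof. by rewrite /splice /prep catw_mkseq. Qed.

Lemma piecewise_thompson r s (f : cantor r -> cantor s) :
  piecewise f -> thompson_like setT f.
Proof.
move=> pf x _; have [m [l fx]] := pf x.
exists (x.1, mkseq x.2 m), ((f x).1, mkseq (f x).2 l); split=> //.
  exists (tl m x.2) => //; rewrite prependE -splice_prepE.
  exact: splice_tl.
by move=> psi; rewrite !prependE -!splice_prepE.
Qed.

Lemma thompson_piecewise r s (f : cantor r -> cantor s) :
  thompson_like setT f -> piecewise f.
Proof.
move=> tf x; have [a [b [[phi _ <-] _ fab]]] := tf x I.
exists (size a.2), (size b.2) => psi.
by rewrite fab !prependE !(@splice_prep _ _ _ phi) -prependE fab.
Qed.

End Thompson.

(** * Rational points *)

Lemma tl_periodic (D : Type) (s : nat -> D) m l c :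
  (forall k, m <= k -> s (k + l) = s k) -> tl (m + c * l) s = tl m s.
Proof.
move=> sl; apply/funext => k; rewrite /tl.
elim: c => [|c IH]; first by rewrite addn0.
by rewrite -[RHS]IH -[RHS]sl; [congr s; rewrite mulSn|]; lia.
Qed.

(** Eventual periods are stable under remainders, so the least one divides all
the others. In particular it divides the distance of two positions with the
same tail, which is the form in which prefix replacements meet it. *)
Lemma minimal_period (D : Type) (s : nat -> D) :
  (exists m p, 0 < p /\ forall k, m <= k -> s (k + p) = s k) ->
  exists m l, [/\ 0 < l, forall k, m <= k -> s (k + l) = s k &
    forall a b, tl a s = tl b s -> a = b %[mod l]].
Proof.
pose ep p := exists m, forall k, m <= k -> s (k + p) = s k.
move=> [m0 [p0 [p0_gt0 sp0]]].
have ex : exists p, (0 < p) && `[< ep p >].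
  by exists p0; rewrite p0_gt0; apply/asboolP; exists m0.
case: (ex_minnP ex) => l /andP[l_gt0 /asboolP[m sl]] lmin.
exists m, l; split => //.
have wl a b : a <= b -> tl a s = tl b s -> a = b %[mod l].
  move=> ab sab; apply/eqP; rewrite eq_sym eqn_mod_dvd // /dvdn -[_ == 0]negbK -lt0n.
  apply/negP => r_gt0; have := ltn_pmod (b - a) l_gt0.
  rewrite ltnNge lmin // r_gt0 /=; apply/asboolP; exists (maxn a m) => k.
  rewrite geq_max => /andP[ak mk].
  have sk t c : m <= t -> s (t + c * l) = s t.
    move=> mt; have := congr1 (fun f => f (t - m)) (tl_periodic c sl).
    by rewrite /tl subnKC // => <-; congr s; lia.
  rewrite -(sk _ ((b - a) %/ l)) ?(leq_trans mk) ?leq_addr //.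
  rewrite -addnA [_ %% _ + _]addnC -divn_eq.
  have := congr1 (fun f => f (k - a)) sab.
  by rewrite /tl subnKC // => ->; congr s; lia.
by move=> a b sab; case: (leqP a b) => [/wl|/ltnW/wl E]; [apply|apply/esym/E].
Qed.

(** A sequence differing from a periodic one splits off the periods on which
both agree. *)
Lemma split_periods (D : Type) (s psi : nat -> D) l :
  0 < l -> (forall k, tl (k * l) s = s) -> psi <> s ->
  exists k phi, psi = glue (k * l) s phi /\ ~ agree l s phi.
Proof.
move=> l_gt0 sl ne.
have ex : exists k, `[< ~ agree (k * l) s psi >].
  have [t st] : exists t, s t <> psi t.
    apply: contrapT => /forallNP eq; apply: ne; apply/funext => t.
    by apply/esym; apply: contrapT; apply: eq.
  by exists t.+1; apply/asboolP => /(_ t) E; apply: st; apply: E; rewrite leq_pmulr.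
case: (ex_minnP ex) => -[/asboolP[] //|k /asboolP nk kmin].
have ak : agree (k * l) s psi.
  by apply: contrapT => /asboolP/kmin; rewrite ltnn.
exists k, (tl (k * l) psi); split; first exact: agreeP.
by move=> al; apply: nk; rewrite mulSnr; apply/agreeD; rewrite sl.
Qed.

(** The complement of the cone of a word [s 0 ... s l.-1] is cut into [n.+1]
pieces. For [l = 1] these are the other cones of depth one. For longer words
there are also the pieces, given by induction, of the complement inside the
cone of [s 0]. To bring these [2 * n.+1] pieces back to [n.+1], the piece of
index [ord0] takes on, by its first digit, both the new cone of index [ord0]
and all the inductive pieces. The target root is a dummy: only the word
matters. *)
Lemma annulus n (s : nat -> 'I_n.+2) l : 0 < l ->
  exists d : 'I_n.+1 * (nat -> 'I_n.+2) -> unit * (nat -> 'I_n.+2),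
    [/\ injective d, piecewise d &
      forall y, (exists x, (d x).2 = y) <-> ~ agree l s y].
Proof.
elim: l s => // -[_ s _|l IH s _].
  pose d (x : 'I_n.+1 * (nat -> 'I_n.+2)) := (tt, glue 1 (fun=> lift (s 0) x.1) x.2).
  exists d; split.
  - move=> [c x] [c' x'] [E]; have := congr1 (fun f => f 0) E.
    rewrite /glue /= => /lift_inj cc; subst c'.
    by have := congr1 (tl 1) E; rewrite !tl_glue => ->.
  - by move=> x; exists 0, 1 => psi; rewrite /d /splice /= glue0 glueK.
  - move=> y; split=> [[x <-] /(_ 0 isT)|ny].
      by rewrite /d /glue /= => /eqP; rewrite (negPf (neq_lift _ _)).
    have s0 : s 0 != y 0 by apply/eqP => E; apply: ny => -[|//] _.
    have [c yc] := unlift_some s0; exists (c, tl 1 y).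
    rewrite /d /= -[RHS](glue_tl 1); apply: agree_glue => -[|//] _.
    by rewrite yc.
have [d [d_inj d_pw d_range]] := IH (tl 1 s) isT.
pose e (x : 'I_n.+1 * (nat -> 'I_n.+2)) :=
  if x.1 == ord0 then
    if unlift ord0 (x.2 0) is Some c then glue 1 s (d (c, tl 1 x.2)).2
    else glue 1 (fun=> lift (s 0) ord0) (tl 1 x.2)
  else glue 1 (fun=> lift (s 0) x.1) x.2.
have eS (c : 'I_n.+1) phi : e (ord0, glue 1 (fun=> lift ord0 c) phi) = glue 1 s (d (c, phi)).2.
  by rewrite /e eqxx {1}/glue /= liftK tl_glue.
have e0 phi : e (ord0, glue 1 (fun=> ord0) phi) = glue 1 (fun=> lift (s 0) ord0) phi.
  by rewrite /e eqxx {1}/glue /= unlift_none tl_glue.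
have e1 c phi : c != ord0 -> e (c, phi) = glue 1 (fun=> lift (s 0) c) phi.
  by rewrite /e /= => /negPf->.
have split1 (x : nat -> 'I_n.+2) : x = glue 1 (fun=> x 0) (tl 1 x).
  by rewrite -[LHS](glue_tl 1); apply: agree_glue => -[].
have view (x : 'I_n.+1 * (nat -> 'I_n.+2)) : [\/ exists c phi, x = (ord0, glue 1 (fun=> lift ord0 c) phi),
    exists phi, x = (ord0, glue 1 (fun=> ord0) phi) | x.1 != ord0].
  case: x => c x /=; case: (eqVneq c ord0) => [->|]; last by constructor 3.
  rewrite (split1 x); case: (unliftP ord0 (x 0)) => [c' ->|->].
    by constructor 1; exists c', (tl 1 x).
  by constructor 2; exists (tl 1 x).
have digit0 (u : nat -> 'I_n.+2) (phi : nat -> 'I_n.+2) : glue 1 u phi 0 = u 0 by [].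
exists (fun x => (tt, e x)); split.
- have out c phi phi' : glue 1 s phi <> glue 1 (fun=> lift (s 0) c) phi'.
    by move=> /(congr1 (fun f => f 0)); rewrite !digit0 => /eqP; rewrite (negPf (neq_lift _ _)).
  have same c c' phi phi' : glue 1 (fun=> lift (s 0) c) phi =
      glue 1 (fun=> lift (s 0) c') phi' -> (c, phi) = (c', phi').
    move=> E; have := congr1 (fun f => f 0) E; have := congr1 (tl 1) E.
    by rewrite !digit0 !tl_glue => -> /lift_inj ->.
  move=> x x' [].
  case: (view x) => [[c [phi ->]]|[phi ->]|]; case: (view x') => [[c' [phi' ->]]|[phi' ->]|];
    rewrite ?eS ?e0.
  + move=> /glue_inj E; have := @d_inj (c, phi) (c', phi').
    by case: (d _) (d _) E => [[] y] [[] y'] /= -> /(_ erefl) [-> ->].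
  + by move/out.
  + by case: x' => c' phi' /= c'0; rewrite e1 // => /out.
  + by move/esym/out.
  + by move/same => [->].
  + by case: x' => c' phi' /= c'0; rewrite e1 // => /same [E]; rewrite -E eqxx in c'0.
  + by case: x => c0 phi0 /= c0n; rewrite e1 // => /esym/out.
  + by case: x => c0 phi0 /= c0n; rewrite e1 // => /same [E]; rewrite E eqxx in c0n.
  + by case: x x' => c0 phi0 [c' phi'] /= c'0 c00; rewrite !e1 // => /same.
- move=> x; case: (view x) => [[c [phi ->]]|[phi ->]|].
  + have [m [p dm]] := d_pw (c, phi); exists (1 + m), (1 + p) => psi.
    rewrite spliceD /splice /= glueK tl_glue eS.
    have := dm psi; rewrite /splice /= => ->.
    by rewrite eS glueD glueK tl_glue.
  + by exists 1, 1 => psi; rewrite /splice /= glueK !e0 glueK.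
  + case: x => c phi /= c0; exists 0, 1 => psi.
    by rewrite /splice /= glue0 !e1 // glueK.
- move=> y; split=> [[x <-] /=|ny].
  + rewrite -[l.+2]/(1 + l.+1) => /agreeD[a1 al].
    case: (view x) a1 al => [[c [phi ->]]|[phi ->]|].
    * by rewrite eS tl_glue => _; apply/d_range; exists (c, phi).
    * rewrite e0 => /(_ 0 isT) E _; move/eqP: E.
      by rewrite digit0 (negPf (neq_lift _ _)).
    * case: x => c phi /= c0; rewrite e1 // => /(_ 0 isT) E _; move/eqP: E.
      by rewrite digit0 (negPf (neq_lift _ _)).
  + case: (unliftP (s 0) (y 0)) => [c yc|y0].
    * case: (eqVneq c ord0) yc => [->|c0] yc.
        by exists (ord0, glue 1 (fun=> ord0) (tl 1 y)); rewrite e0 -yc -split1.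
      by exists (c, tl 1 y); rewrite /= e1 // -yc -split1.
    * have /d_range[[c phi] E] : ~ agree l.+1 (tl 1 s) (tl 1 y).
        move=> al; apply: ny; rewrite -[l.+2]/(1 + l.+1); apply/agreeD.
        by split=> // -[].
      exists (ord0, glue 1 (fun=> lift ord0 c) phi); rewrite eS E.
      by rewrite [RHS]split1; apply: agree_glue => -[].
Qed.

(** * Charts of the complement of a finite set of rational points *)

Section Chart.
Variables n q k : nat.
Local Notation D := 'I_n.+2.
Local Notation str := (nat -> D).
Local Notation cpt := ('I_q * str)%type.
Local Notation mpt := (('I_k * nat) * str)%type.

(** Distinct rational points, with a depth at which their prefixes are distinct
and from which on each of them is periodic, and with their least periods. *)
Record ends := Ends {
  center : 'I_k -> cpt;
  depth : nat;
  period : 'I_k -> nat;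
  center_sep : forall i i', (center i).1 = (center i').1 ->
    agree depth (center i).2 (center i').2 -> i = i';
  period_gt0 : forall i, 0 < period i;
  centerP : forall i t, depth <= t ->
    (center i).2 (t + period i) = (center i).2 t;
  period_min : forall i a b, tl a (center i).2 = tl b (center i).2 ->
    a = b %[mod period i] }.

Variable E : ends.
Local Notation s := (center E).
Local Notation L := (depth E).
Local Notation l := (period E).

(** The cone around [s i] whose prefix contains [a] periods. *)
Definition near_center i a (psi : str) : cpt := splice (L + a * l i) (s i) psi.

Lemma tl_center i a : tl (L + a * l i) (s i).2 = tl L (s i).2.
Proof. exact/tl_periodic/centerP. Qed.

Lemma tl_tl_center i a : tl (a * l i) (tl L (s i).2) = tl L (s i).2.
Proof. by rewrite -tlD tl_center. Qed.

Lemma near_centerD i a b psi :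
  near_center i (a + b) psi = near_center i a (glue (b * l i) (tl L (s i).2) psi).
Proof. by rewrite /near_center mulnDl addnA spliceD tl_center. Qed.

Lemma near_center_fix i a : near_center i a (tl L (s i).2) = s i.
Proof. by rewrite /near_center -(tl_center i a) splice_tl. Qed.

Lemma near_centerP i a psi : psi <> tl L (s i).2 ->
  exists b phi, psi = glue (b * l i) (tl L (s i).2) phi /\
    near_center i a psi = near_center i (a + b) phi /\
    ~ agree (l i) (tl L (s i).2) phi.
Proof.
move=> ne; have [b [phi [psiE na]]] :=
  split_periods (period_gt0 E i) (tl_tl_center i) ne.
by exists b, phi; rewrite near_centerD -psiE.
Qed.

(** A local prefix replacement fixing a rational point replaces two of its
prefixes with the same tail, so it drops or inserts whole periods. *)
Lemma fix_center f i : piecewise f -> f (s i) = s i ->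
  exists a b, forall psi, f (near_center i a psi) = near_center i b psi.
Proof.
move=> pf fs; have [m [p fx]] := pf (s i).
have tlE : tl m (s i).2 = tl p (s i).2 by rewrite -(replaces_tail fx) fs.
have l0 := period_gt0 E i.
have ml : m <= m * l i by rewrite leq_pmulr.
pose d := L + m * l i - m.
have fd := replaces_shift d fx; rewrite /replaces fs in fd.
have md : m + d = L + m * l i by rewrite subnKC // (leq_trans ml) ?leq_addl.
have /eqP pd : p + d = L %[mod l i].
  have : m + d = p + d %[mod l i] by apply: period_min; rewrite !tlD tlE.
  by rewrite md [in LHS]addnC modnMDl => ->.
have Lp : L <= p + d.
  by rewrite /d; move: ml; lia.
move: pd; rewrite eqn_mod_dvd // => /dvdnP[b pb].
by exists m, b => psi; rewrite /near_center -md -pb subnKC //.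
Qed.

(** A parametrization of the complement of the centers by [k] sequences of
cones. From index [offset i] on, the end [i] runs through the pieces
of the annuli around [s i], [n.+1] pieces for each period, and in every annulus
in the same way: thus adding [n.+1] to the index amounts to inserting a period
in the prefix. *)
Record chart := Chart {
  chart_fun :> mpt -> cpt;
  offset : 'I_k -> nat;
  piece : 'I_k -> 'I_n.+1 * str -> str;
  piece_range : forall i y, (exists x, piece i x = y) <->
    ~ agree (l i) (tl L (s i).2) y;
  chart_inj : injective chart_fun;
  chart_piecewise : piecewise chart_fun;
  chart_range : forall y, (exists x, chart_fun x = y) <-> ~ exists i, y = s i;
  chart_end : forall i a c psi,
    chart_fun ((i, offset i + (a * n.+1 + val c)), psi) =
    near_center i a (piece i (c, psi)) }.

Variable e : chart.

Lemma chart_or_center y : (exists x, e x = y) \/ exists i, y = s i.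
Proof.
have [yi|ni] := pselect (exists i, y = s i); first by right.
by left; apply/chart_range.
Qed.

Lemma chart_neq_center x i : e x <> s i.
Proof. by have [/(_ (ex_intro _ x erefl)) ne _] := chart_range e (e x); move=> ex; apply: ne; exists i. Qed.

Lemma restrict_exists (f : cpt -> cpt) : injective f -> (forall i, f (s i) = s i) ->
  exists g, forall x, e (g x) = f (e x).
Proof.
move=> f_inj fs; have ex x : exists y, e y = f (e x).
  have [//|[i]] := chart_or_center (f (e x)).
  by rewrite -{1}fs => /f_inj /chart_neq_center.
by have [g gP] := choice ex; exists g.
Qed.

(** Near [s i] the map inserts [b] periods in place of [a]; in the chart this is
a shift by [b - a] times [n.+1]. *)
Lemma restrict_shifts (f : cpt -> cpt) g i : piecewise f -> f (s i) = s i ->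
  (forall x, e (g x) = f (e x)) -> exists z, shifts_end g i z.
Proof.
move=> pf fs eg; have [a [b fab]] := fix_center pf fs.
exists (b%:Z - a%:Z)%R, (offset e i + a * n.+1), (offset e i + b * n.+1); split.
  by rewrite !PoszD !PoszM; lia.
move=> j psi; apply: (@chart_inj e); rewrite eg.
have jE : j = j %/ n.+1 * n.+1 + val (Ordinal (ltn_pmod j (ltn0Sn n))).
  exact: divn_eq.
have shiftE a' : offset e i + a' * n.+1 + j = offset e i + ((a' + j %/ n.+1) * n.+1
    + val (Ordinal (ltn_pmod j (ltn0Sn n)))).
  by rewrite {1}jE mulnDl !addnA.
by rewrite !shiftE !chart_end !near_centerD fab.
Qed.

Lemma restrict_model (f f' : cpt -> cpt) : cancel f f' -> cancel f' f -> piecewise f ->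
  (forall i, f (s i) = s i) ->
  exists g : model n k, forall x, e (g x) = f (e x).
Proof.
move=> fK f'K pf fs.
have f's i : f' (s i) = s i by rewrite -{1}fs fK.
have [g eg] := restrict_exists (can_inj fK) fs.
have [g' eg'] := restrict_exists (can_inj f'K) f's.
have gK : cancel g g' by move=> x; apply: (@chart_inj e); rewrite eg' eg fK.
have g'K : cancel g' g by move=> x; apply: (@chart_inj e); rewrite eg eg' f'K.
have pg : piecewise g.
  apply: (piecewise_lift (@chart_inj e) (@chart_piecewise e) _ eg).
  exact: piecewise_comp (@chart_piecewise e) pf.
by exists (Model gK g'K pg (fun i => restrict_shifts pf (fs i) eg)).
Qed.

Lemma extend_exists (g : mpt -> mpt) :
  exists f, (forall x, f (e x) = e (g x)) /\ forall i, f (s i) = s i.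
Proof.
have ex y : exists z, (forall x, y = e x -> z = e (g x)) /\
    forall i, y = s i -> z = s i.
  have [[x <-]|[i ->]] := chart_or_center y.
    exists (e (g x)); split=> [x' /chart_inj -> //|i /chart_neq_center //].
  exists (s i); split=> [x /esym/chart_neq_center //|//].
have [f fP] := choice ex; exists f.
by split=> [x|i]; [apply: (fP _).1|apply: (fP _).2].
Qed.

(** The converse of [restrict_shifts]: a shift by whole periods far out on the
end [i] makes the extension a prefix replacement around [s i]. *)
Lemma extend_center (g : model n k) (f : cpt -> cpt) i :
  (forall x, f (e x) = e (g x)) -> f (s i) = s i ->
  exists m p, replaces m p f (s i).
Proof.
move=> fe fs; have [A [B [BE gAB]]] := chiP i g.
(* With [A] periods in the prefix all indices are at least [A], where [g] is
   known; their image has [b] periods. *)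
have z0 : (0 <= A%:Z + chi i g)%R.
  rewrite -(@pmulr_rge0 _ (Posz n.+1)) // mulrDr -subr_ge0 subr0.
  have -> : (n.+1%:Z * A%:Z + n.+1%:Z * chi i g = n%:Z * A%:Z + B%:Z)%R.
    by rewrite BE; lia.
  by [].
have [b bE] : exists b : nat, (b%:Z = A%:Z + chi i g)%R.
  by exists `|(A%:Z + chi i g)%R|%N; rewrite gez0_abs.
have bnE : b * n.+1 + A = B + A * n.+1.
  by apply/eqP; rewrite -eqz_nat !PoszD !PoszM bE BE; apply/eqP; lia.
exists (L + A * l i), (L + b * l i) => psi.
rewrite fs -!/(near_center i _ psi).
have [->|ne] := pselect (psi = tl L (s i).2).
  by rewrite !near_center_fix.
have [c [phi [-> [_ /(piece_range e)[[r chi'] phiE]]]]] := near_centerP A ne.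
rewrite -!near_centerD -phiE -!chart_end fe.
have -> : offset e i + ((A + c) * n.+1 + r) = A + (offset e i + A * n + c * n.+1 + r).
  by lia.
rewrite gAB; congr (e (_, _, _)).
by rewrite /=; lia.
Qed.

Lemma extend_piecewise (g : model n k) (f : cpt -> cpt) :
  (forall x, f (e x) = e (g x)) -> (forall i, f (s i) = s i) -> piecewise f.
Proof.
move=> fe fs y; have [[x <-]|[i ->]] := chart_or_center y; last first.
  exact: extend_center fe (fs i).
have [m [p gx]] := piecewise_comp (@model_piecewise _ _ g) (@chart_piecewise e) x.
have [m' [p' ex]] := @chart_piecewise e x.
exists (p' + m), (p + m') => psi.
rewrite -(replaces_shift m ex) fe -[e (g _)]/((e \o g) _).
by rewrite addnC (replaces_shift m' gx) /= fe.
Qed.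

End Chart.

(** * Fixators and the model group *)

Lemma Fix_fixes n r (S : set (cantor_nr n r)) (f : Fix S) x : S x -> f x = x.
Proof. by move=> Sx; case: f => f fS /=; move/asboolP: fS; apply. Qed.

Lemma Fix_ext n r (S : set (cantor_nr n r)) (f g : Fix S) : f =1 g -> f = g.
Proof. by move=> fg; apply/val_inj/ht_ext. Qed.

(** Conjugation by a chart: elements of [Fix S] preserve the complement of [S],
which the chart parametrizes, and elements of the model group extend by the
identity on [S]. *)
Lemma Fix_model n q k (E : ends n q k) (e : chart E)
    (S : set (cantor_nr n.+2 q)) :
  (forall x, S x <-> exists i, x = center E i) ->
  group_isomorphic (Fix S) (model n k).
Proof.
move=> SE; have Sc i : S (center E i) by apply/SE; exists i.
have toM (f : Fix S) : exists g : model n k, forall x, e (g x) = f (e x).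
  apply: (restrict_model e (@ht_funK _ _ f) (@ht_invK _ _ f)).
    exact/thompson_piecewise/ht_thompson.
  by move=> i; apply/Fix_fixes/Sc.
have [F FP] := choice toM.
have ofM (g : model n k) : exists f : Fix S, forall x, f (e x) = e (g x).
  have [f [fe fc]] := extend_exists e g.
  have [f' [f'e f'c]] := extend_exists e (model_V g).
  have K (h h' : model n k) u u' : (forall x, u (e x) = e (h x)) ->
      (forall x, u' (e x) = e (h' x)) -> (forall i, u (center E i) = center E i) ->
      (forall i, u' (center E i) = center E i) -> cancel h h' -> cancel u u'.
    move=> ue u'e uc u'c hK y; have [[x <-]|[i ->]] := chart_or_center e y.
      by rewrite ue u'e hK.
    by rewrite uc u'c.
  have pf := extend_piecewise fe fc.
  have hf := piecewise_homeomorphism pf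
    (K g (model_V g) _ _ fe f'e fc f'c (@model_funK _ _ g))
    (K (model_V g) g _ _ f'e fe f'c fc (@model_invK _ _ g)).
  have ff : HigmanThompson hf (piecewise_thompson pf) \in fixes S.
    by apply/asboolP => x /SE[i ->]; exact: fc.
  by exists (MkFix ff).
have [G GP] := choice ofM.
exists F.
  move=> f g; apply: model_ext => x; apply: (@chart_inj _ _ _ _ e).
  by rewrite model_mulE !FP.
exists G => [f|g].
  apply: Fix_ext => y; have [[x <-]|[i ->]] := chart_or_center e y.
    by rewrite GP FP.
  by rewrite !Fix_fixes.
by apply: model_ext => x; apply: (@chart_inj _ _ _ _ e); rewrite FP GP.
Qed.

(** Finitely many points: all the required depths have a maximum. *)
Lemma ends_exist n q k (s : 'I_k -> 'I_q * (nat -> 'I_n.+2)) :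
  injective s -> (forall i, exists m p, 0 < p /\
    forall t, m <= t -> (s i).2 (t + p) = (s i).2 t) ->
  exists E : ends n q k, forall i, center E i = s i.
Proof.
move=> s_inj s_rat.
have [m0 m0P] := choice (fun i => minimal_period (s_rat i)).
have [l lP] := choice m0P.
have sep (p : 'I_k * 'I_k) : exists t, (s p.1).1 = (s p.2).1 ->
    agree t (s p.1).2 (s p.2).2 -> p.1 = p.2.
  case: p => i i' /=; have [<-|ne] := eqVneq i i'; first by exists 0.
  have [E1|N1] := eqVneq (s i).1 (s i').1; last by exists 0 => /eqP; rewrite (negPf N1).
  have [t nt] : exists t, (s i).2 t <> (s i').2 t.
    apply: contrapT => /forallNP eq; move/eqP: ne; apply; apply: s_inj.
    rewrite [LHS]surjective_pairing [RHS]surjective_pairing E1; congr (_, _).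
    by apply/funext => t; apply: contrapT; apply: eq.
  by exists t.+1 => _ /(_ t (ltnSn t)).
have [t0 t0P] := choice sep.
pose L := maxn (\max_i m0 i) (\max_p t0 p).
have Lm i : m0 i <= L by rewrite leq_max leq_bigmax.
have Lt p : t0 p <= L by rewrite leq_max leq_bigmax orbT.
have s_sep i i' : (s i).1 = (s i').1 -> agree L (s i).2 (s i').2 -> i = i'.
  by move=> E1 al; apply: (t0P (i, i')) => //; apply: agree_le al; apply: Lt.
have l0 i : 0 < l i by have [] := lP i.
have sl i t : L <= t -> (s i).2 (t + l i) = (s i).2 t.
  by move=> Lt'; have [_ per _] := lP i; apply: per; apply: leq_trans Lt'.
have smin i a b : tl a (s i).2 = tl b (s i).2 -> a = b %[mod l i].
  by have [_ _] := lP i; apply.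
by exists (Ends s_sep l0 sl smin).
Qed.

(** All cones of a common depth that avoid the centers are put in front of the
first end, which absorbs them: an end followed far enough forgets any finite
number of cones before it. *)
Lemma chart_exists n q k (E : ends n q k.+1) : inhabited (chart E).
Proof.
pose s := center E; pose L := depth E; pose l := period E.
have [d dP] := choice (fun i => annulus (tl L (s i).2) (period_gt0 E i)).
pose P := ('I_q * L.-tuple 'I_n.+2)%type.
pose pre (y : 'I_q * (nat -> 'I_n.+2)) : P := (y.1, [tuple of mkseq y.2 L]).
have preE (p : P) psi : pre (prep (p.1, val p.2) psi) = p.
  case: p => i u; congr (_, _); apply: val_inj => /=.
  by have /eqP := starts_catw u psi; rewrite size_tuple.
have pre_prep y : y = prep ((pre y).1, val (pre y).2) (tl L y.2).
  by rewrite /prep /= catw_mkseq glue_tl; exact: surjective_pairing.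
have pre_agree y y' : pre y = pre y' -> y.1 = y'.1 /\ agree L y.2 y'.2.
  by move=> [-> E2]; split=> //; apply/mkseq_agree.
pose rest := [seq p <- enum {: P} | [forall i, p != pre (s i)]].
pose m := size rest.
(* The default value is never reached: [R] is used below [m] only. *)
pose R j := nth (pre (s ord0)) rest j.
have R_pre j i : j < m -> R j != pre (s i).
  by move=> jm; have := mem_nth (pre (s ord0)) jm; rewrite mem_filter => /andP[/forallP].
pose off (i : 'I_k.+1) := if i == ord0 then m else 0.
pose pc i x := (d i x).2.
have pc_inj i : injective (pc i).
  have [d_inj _ _] := dP i; move=> x y; rewrite /pc => E'; apply: d_inj.
  by case: (d i x) (d i y) E' => [[] u] [[] v] /= ->.
have pc_range i : forall y, (exists x, pc i x = y) <-> ~ agree (l i) (tl L (s i).2) y.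
  by have [] := dP i.
pose cls j : 'I_n.+1 := Ordinal (ltn_pmod j (ltn0Sn n)).
pose e (x : ('I_k.+1 * nat) * (nat -> 'I_n.+2)) : 'I_q * (nat -> 'I_n.+2) :=
  let: ((i, j), psi) := x in
  if j < off i then prep ((R j).1, val (R j).2) psi
  else near_center E i ((j - off i) %/ n.+1) (pc i (cls (j - off i), psi)).
have e_front i j psi : j < off i -> e (i, j, psi) = prep ((R j).1, val (R j).2) psi.
  by rewrite /e => ->.
have e_end i a (c : 'I_n.+1) psi :
    e ((i, off i + (a * n.+1 + c)), psi) = near_center E i a (pc i (c, psi)).
  rewrite /e ltnNge leq_addr /= addKn divnMDl // divn_small // addn0.
  congr (near_center _ _ _ (pc _ (_, _))); apply: val_inj => /=.
  by rewrite modnMDl modn_small.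
have off_m i j : j < off i -> i = ord0 /\ j < m.
  by rewrite /off; case: eqP.
have view (x : ('I_k.+1 * nat) * (nat -> 'I_n.+2)) : (x.1.2 < off x.1.1) \/
    exists i a (c : 'I_n.+1) psi, x = (i, off i + (a * n.+1 + c), psi).
  case: x => -[i j] psi /=; case: ltnP => ij; first by left.
  right; exists i, ((j - off i) %/ n.+1), (cls (j - off i)), psi.
  by rewrite /= -divn_eq subnKC.
have pre_near i a psi : pre (near_center E i a psi) = pre (s i).
  congr (_, _); apply: val_inj => /=; apply/mkseq_agree => t tL.
  by rewrite /glue ltn_addr.
have pre_front i j psi : j < off i -> pre (e (i, j, psi)) = R j.
  by move=> ij; rewrite e_front.
have pc_na i x : ~ agree (l i) (tl L (s i).2) (pc i x).
  by apply/pc_range; exists x.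
have near_lt i a b x psi : near_center E i a (pc i x) <> near_center E i (a + b.+1) psi.
  rewrite near_centerD => /splice_inj E'; apply: (pc_na i x); rewrite E'.
  apply/agree_sym/(agree_le _ (@glue_agree _ _ _ _)).
  by rewrite mulSn leq_addr.
have e_inj : injective e.
  move=> x x'; case: (view x) => [|[i [a [c [psi ->]]]]];
    case: (view x') => [|[i' [a' [c' [psi' ->]]]]].
  - case: x x' => -[i j] psi [[i' j'] psi'] ij' ij E'; rewrite /= in ij ij'.
    have [i0 jm] := off_m _ _ ij; have [i0' jm'] := off_m _ _ ij'.
    have RR : R j = R j' by rewrite -(pre_front _ _ psi ij) E' pre_front.
    have jj : j = j'.
      apply/eqP; rewrite -(nth_uniq (pre (s ord0)) jm jm').
        exact/eqP.
      exact/filter_uniq/enum_uniq.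
    move: E'; rewrite e_front // e_front // -jj => /prep_inj ->.
    by rewrite i0 i0'.
  - case: x => -[i j] psi ij; rewrite /= in ij; rewrite e_end => /(congr1 pre).
    rewrite pre_front // pre_near => /eqP; rewrite (negPf (R_pre _ _ _)) //.
    by have [] := off_m _ _ ij.
  - case: x' => -[i' j] psi' ij; rewrite /= in ij; rewrite e_end => /(congr1 pre).
    rewrite pre_front // pre_near => /esym/eqP; rewrite (negPf (R_pre _ _ _)) //.
    by have [] := off_m _ _ ij.
  - rewrite !e_end => E'; have := congr1 pre E'; rewrite !pre_near.
    move=> /pre_agree[E1 E2]; have ii : i = i' by apply: (center_sep E1 E2).
    subst i'; have aa : a = a'.
      case: (ltngtP a a') => // lt; exfalso.
        by move: E'; rewrite -(subnKC lt) addSnnS => /near_lt.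
      by move/esym: E'; rewrite -(subnKC lt) addSnnS => /near_lt.
    by subst a'; move/splice_inj/pc_inj: E' => -[-> ->].
have e_pw : piecewise e.
  move=> x; case: (view x) => [|[i [a [c [psi ->]]]]].
    case: x => -[i j] psi ij; exists 0, L => phi.
    rewrite /splice /= glue0 !ij /prep /=.
    by have := catw_glue (R j).2 psi phi; rewrite size_tuple => ->.
  have [_ d_pw _] := dP i; have [m' [p dm]] := d_pw (c, psi).
  exists m', (L + a * l i + p) => phi.
  have := dm phi; rewrite {1 2}/splice [fst (_, _)]/= [snd (_, _)]/= => dphi.
  rewrite {1}/splice [fst (_, _)]/= [snd (_, _)]/= !e_end /pc dphi.
  by rewrite /near_center /splice /= (glueD (L + a * l i) p) glueK tl_glue.
have e_range y : (exists x, e x = y) <-> ~ exists i, y = s i.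
  split=> [[x <-] [i]|ns].
    case: (view x) => [|[i' [a [c [psi ->]]]]].
      case: x => -[i' j] psi ij; rewrite /= in ij; move=> /(congr1 pre); rewrite pre_front //.
      by move/eqP; rewrite (negPf (R_pre _ _ _)) //; have [] := off_m _ _ ij.
    rewrite e_end => E'; have := congr1 pre E'; rewrite pre_near.
    move=> /pre_agree[E1 E2]; have ii : i' = i by apply: (center_sep E1 E2).
    subst i'; have /splice_inj E3 := etrans E' (esym (near_center_fix E i a)).
    by apply: (pc_na i (c, psi)); rewrite E3.
  case: (boolP [forall i, pre y != pre (s i)]) => [yR|].
    have yr : pre y \in rest by rewrite mem_filter yR mem_enum.
    exists ((ord0, index (pre y) rest), tl L y.2).
    have ir : index (pre y) rest < off ord0 by rewrite /off eqxx index_mem.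
    by rewrite e_front // /R nth_index // -pre_prep.
  rewrite negb_forall => /existsP[i]; rewrite negbK => /eqP/pre_agree[y1 yL].
  have yE : y = near_center E i 0 (tl L y.2).
    rewrite /near_center mul0n addn0 /splice -/(s i) -y1 -(agree_glue _ yL) glue_tl.
    exact: surjective_pairing.
  have ne : tl L y.2 <> tl L (s i).2.
    by move=> E'; apply: ns; exists i; rewrite yE E' near_center_fix.
  have [b [phi [_ [E' /pc_range[[c psi] pE]]]]] := near_centerP 0 ne.
  by exists ((i, off i + ((0 + b) * n.+1 + c)), psi); rewrite e_end yE E' pE.
exact: inhabits (@Chart n q k.+1 E e off pc pc_range e_inj e_pw e_range e_end).
Qed.

Lemma finite_enum (T : Type) (S : set T) k :
  S #= `I_k -> exists s : 'I_k -> T, injective s /\ forall x, S x <-> exists i, x = s i.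
Proof.
rewrite (card_eqr card_II) => /card_bijP[f [g fK gK]].
pose up (i : 'I_k) : [set: 'I_k] := SigSub (mem_set (I : [set: 'I_k] i)).
exists (fun i => set_val (g (up i))); split.
  move=> i j /val_inj /(can_inj gK) E; by have := congr1 set_val E.
move=> x; split=> [Sx|[i ->]]; last exact: set_mem (valP (g (up i))).
pose x' : S := SigSub (mem_set Sx); exists (set_val (f x')).
by rewrite (_ : up _ = f x') ?fK //; apply: val_inj.
Qed.

Lemma Fix_model_card n q (S : set (cantor_nr n.+2 q)) : finite_set S ->
  S !=set0 -> (forall x, S x -> rational x) ->
  exists k, S #= `I_k /\ group_isomorphic (Fix S) (model n k).
Proof.
move=> /finite_setP[[|k] Sk] [x Sx] S_rat.
  by move: Sk; rewrite II0 card_eq0 => /eqP S0; rewrite S0 in Sx.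
exists k.+1; split=> //; have [s [s_inj sP]] := finite_enum Sk.
have [i|E Ec] := @ends_exist n q k.+1 s s_inj.
  by apply: S_rat; apply/sP; exists i.
have [e] := chart_exists E; apply: (Fix_model e) => y.
by rewrite sP; split=> -[i ->]; exists i; rewrite Ec.
Qed.

Lemma group_isomorphic_sym (G H : groupType) :
  group_isomorphic G H -> group_isomorphic H G.
Proof.
move=> [f fM [g fK gK]]; exists g; last by exists f.
by move=> x y; apply: (can_inj fK); rewrite fM !gK.
Qed.

Lemma group_isomorphic_trans (G H K : groupType) :
  group_isomorphic G H -> group_isomorphic H K -> group_isomorphic G K.
Proof.
move=> [f fM f_bij] [g gM g_bij]; exists (g \o f); last exact: bij_comp.
by move=> x y /=; rewrite fM gM.
Qed.

Theorem theorem2 (n q r : nat) (n_ge2 : (2 <= n)%N) (q_ge1 : (1 <= q)%N)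
    (r_ge1 : (1 <= r)%N)
    (S : set (cantor_nr n q)) (S' : set (cantor_nr n r))
    (S_fin : finite_set S) (S_nonempty : S !=set0)
    (S_rat : forall x, S x -> rational x)
    (S'_fin : finite_set S') (S'_nonempty : S' !=set0)
    (S'_rat : forall x, S' x -> rational x) :
  group_isomorphic (Fix S) (Fix S') <-> S #= S'.
Proof.
case: n n_ge2 S S' S_fin S_nonempty S_rat S'_fin S'_nonempty S'_rat => [|[|n]] // _.
move=> S S' S_fin S_nonempty S_rat S'_fin S'_nonempty S'_rat.
have [k [Sk isoS]] := Fix_model_card S_fin S_nonempty S_rat.
have [k' [S'k' isoS']] := Fix_model_card S'_fin S'_nonempty S'_rat.
split=> [iso|SS'].
  have kk' : k = k'.
    apply/model_rank/(group_isomorphic_trans _ isoS').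
    exact: group_isomorphic_trans (group_isomorphic_sym isoS) iso.
  by apply: card_eq_trans Sk _; rewrite kk' card_eq_sym.
have kk' : k = k'.
  apply/card_eq_II; apply: card_eq_trans (card_eq_trans SS' S'k').
  by rewrite card_eq_sym.
apply: group_isomorphic_trans isoS _; rewrite kk'.
exact: group_isomorphic_sym.
Qed.
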